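(* Let $G$ be a locally compact group and let $\alpha:G\to\mathrm{Aut}(\mathcal{A})$ be a strongly continuous action on a $C^*$-algebra $\mathcal{A}$. Then the pair $(\mathcal{A},\mathcal{A}\times_{\alpha,r}G)$ has the completely contractive factorization property (CCFP).
   Context: CCFP: an ordered pair $(\mathcal{A},\mathcal{B})$ of $C^*$-algebras has the completely contractive factorization property (CCFP) if, given $\varepsilon>0$ and $a_1,\dots,a_n\in\mathcal{A}$, there exist completely contractive linear maps $S:\mathcal{A}\to\mathcal{B}$ and $T:\mathcal{B}\to\mathcal{A}$ such that $\|T(S(a_i))-a_i\|<\varepsilon$ for $1\le i\le n$. Strongly continuous action: a homomorphism $\alpha:G\to\mathrm{Aut}(\mathcal{A})$ such that $t\mapsto\alpha_t(a)$ is norm-continuous for every $a\in\mathcal{A}$. Reduced crossed product $\mathcal{A}\times_{\alpha,r}G$: take a faithful representation $\pi:\mathcal{A}\to B(H)$; define $\tilde\pi:\mathcal{A}\to B(L^2(G,H))$ by $(\tilde\pi(a)\xi)(t)=\pi(\alpha_{t^{-1}}(a))\xi(t)$ and unitaries $\lambda_s$ by $(\lambda_s\xi)(t)=\xi(s^{-1}t)$. Then $\mathcal{A}\times_{\alpha,r}G$ is the norm closed linear span of the operators $\int f(s)\tilde\pi(a)\lambda_s\,ds$, with $a\in\mathcal{A}$, $f$ a continuous compactly supported function on $G$, and $ds$ left Haar measure. It is a $C^*$-algebra independent of the choice of $\pi$. *)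

(* Defs.v *)
From HB Require Import structures.
From mathcomp Require Import all_boot all_order all_algebra.
From mathcomp Require Import all_classical all_reals all_analysis.
From mathcomp Require Import complex.

Set Implicit Arguments.
Unset Strict Implicit.
Unset Printing Implicit Defensive.

Import Order.TTheory GRing.Theory Num.Theory.
Import numFieldNormedType.Exports.

Local Open Scope classical_set_scope.
Local Open Scope ring_scope.

(* Norms of complex normed modules take values in R[i] (as nonnegative reals);
   z <= w in R[i] means that w - z is a nonnegative real. *)

(* C*-algebras are not assumed unital, so the library's (unital) rings do not
   apply. *)
HB.mixin Record CompleteNormedModule_isCStarAlg (R : realType) (A : Type)
    of CompleteNormedModule R[i] A := {
  cmul : A -> A -> A;
  cstar : A -> A;
  cmulA : forall a b c, cmul a (cmul b c) = cmul (cmul a b) c;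
  cmul_linearl : forall (z : R[i]) a b c,
    cmul (z *: a + b) c = z *: cmul a c + cmul b c;
  cmul_linearr : forall (z : R[i]) a b c,
    cmul c (z *: a + b) = z *: cmul c a + cmul c b;
  cstarK : forall a, cstar (cstar a) = a;
  cstar_semilinear : forall (z : R[i]) a b,
    cstar (z *: a + b) = z^* *: cstar a + cstar b;
  cstarM : forall a b, cstar (cmul a b) = cmul (cstar b) (cstar a);
  cmul_norm : forall a b, `|cmul a b| <= `|a| * `|b|;
  cstar_norm : forall a, `|cmul (cstar a) a| = `|a| ^+ 2
}.

#[short(type="cstarAlgType")]
HB.structure Definition CStarAlg (R : realType) :=
  {A of CompleteNormedModule_isCStarAlg R A & CompleteNormedModule R[i] A}.

(* The inner product is linear in its first argument. *)
HB.mixin Record CompleteNormedModule_isHilbert (R : realType) (H : Type)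
    of CompleteNormedModule R[i] H := {
  dotp : H -> H -> R[i];
  dotp_linearl : forall (z : R[i]) x y w,
    dotp (z *: x + y) w = z * dotp x w + dotp y w;
  dotpC : forall x y, dotp y x = (dotp x y)^*;
  dotp_norm : forall x, dotp x x = `|x| ^+ 2
}.

#[short(type="hilbertType")]
HB.structure Definition Hilbert (R : realType) :=
  {H of CompleteNormedModule_isHilbert R H & CompleteNormedModule R[i] H}.

HB.mixin Record Topological_isTopologicalGroup (G : Type)
    of Topological G & Group G := {
  mulg_continuous : continuous (fun p : G * G => (p.1 * p.2)%g);
  invg_continuous : continuous (fun x : G => (x^-1)%g)
}.

(* Pointed because the library's generated sigma-algebras require it. *)
#[short(type="topologicalGroupType")]
HB.structure Definition TopologicalGroup :=
  {G of Topological_isTopologicalGroup G & Pointed G & Topological G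
      & Group G}.

Section MatrixNorms.
Variables (R : realType) (A : cstarAlgType R).

Definition mx_cmul n (x y : 'M[A]_n) : 'M[A]_n :=
  \matrix_(i, j) \sum_k cmul (x i k) (y k j).

Definition mx_cstar n (x : 'M[A]_n) : 'M[A]_n := \matrix_(i, j) cstar (x j i).

(* N makes the *-algebra M_n(A) a C*-algebra. *)
Record is_cstar_mxnorm n (N : 'M[A]_n -> R[i]) : Prop := IsCStarMxNorm {
  mxnorm_ge0 : forall x, 0 <= N x;
  mxnorm_eq0 : forall x, N x = 0 -> x = 0;
  mxnormD : forall x y, N (x + y) <= N x + N y;
  mxnormZ : forall (z : R[i]) x, N (map_mx (fun a => z *: a) x) = `|z| * N x;
  mxnormM : forall x y, N (mx_cmul x y) <= N x * N y;
  mxnorm_cstar : forall x, N (mx_cmul (mx_cstar x) x) = N x ^+ 2;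
  mxnorm_complete : forall u : nat -> 'M[A]_n,
    (forall e : R[i], 0 < e ->
       exists m, forall i j, (m <= i)%N -> (m <= j)%N -> N (u i - u j) < e) ->
    exists l, forall e : R[i], 0 < e ->
       exists m, forall i, (m <= i)%N -> N (u i - l) < e
}.

(* The C*-norm of M_n(A): it exists and is unique. *)
Definition cstar_mxnorm n : 'M[A]_n -> R[i] :=
  xget (fun=> 0) [set N | is_cstar_mxnorm N].

End MatrixNorms.

Definition completely_contractive (R : realType) (A B : cstarAlgType R)
    (S : {linear A -> B}) : Prop :=
  forall n (x : 'M[A]_n), cstar_mxnorm (map_mx S x) <= cstar_mxnorm x.

Definition CCFP (R : realType) (A B : cstarAlgType R) : Prop :=
  forall (e : R[i]) (n : nat) (a : 'I_n -> A), 0 < e ->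
    exists (S : {linear A -> B}) (T : {linear B -> A}),
      [/\ completely_contractive S, completely_contractive T &
          forall i, `|T (S (a i)) - a i| < e].

Record is_star_automorphism (R : realType) (A : cstarAlgType R) (f : A -> A)
    : Prop := IsStarAutomorphism {
  staraut_linear : linear f;
  starautM : forall a b, f (cmul a b) = cmul (f a) (f b);
  staraut_cstar : forall a, f (cstar a) = cstar (f a);
  staraut_bij : bijective f
}.

Record strongly_continuous_action (G : topologicalGroupType) (R : realType)
    (A : cstarAlgType R) (alpha : G -> A -> A) : Prop :=
  StronglyContinuousAction {
  action_aut : forall t, is_star_automorphism (alpha t);
  actionM : forall s t a, alpha (s * t)%g a = alpha s (alpha t a);
  action_continuous : forall a, continuous (fun t => alpha t a)
}.

Section Operators.
Variables (R : realType) (H : hilbertType R).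

Definition op_bound (T : H -> H) (M : R[i]) : Prop :=
  0 <= M /\ forall x, `|T x| <= M * `|x|.

Definition bounded_operator (T : H -> H) : Prop :=
  linear T /\ exists M, op_bound T M.

Definition is_opnorm (T : H -> H) (M : R[i]) : Prop :=
  op_bound T M /\ forall M', op_bound T M' -> M <= M'.

Inductive in_span (P : set (H -> H)) : set (H -> H) :=
| in_span_comb (n : nat) (c : 'I_n -> R[i]) (X : 'I_n -> H -> H) of
    (forall i, P (X i)) : in_span P (fun x => \sum_i c i *: X i x).

(* The closed linear span for the operator norm. *)
Definition closed_span (P : set (H -> H)) : set (H -> H) :=
  [set T | bounded_operator T /\
     forall e : R[i], 0 < e ->
       exists2 Y, in_span P Y & op_bound (fun x => T x - Y x) e].

Variable A : cstarAlgType R.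

Record is_representation (pi : A -> H -> H) : Prop := IsRepresentation {
  rep_bounded : forall a, bounded_operator (pi a);
  rep_linear : forall (z : R[i]) a b x,
    pi (z *: a + b) x = z *: pi a x + pi b x;
  repM : forall a b x, pi (cmul a b) x = pi a (pi b x);
  rep_cstar : forall a x y, dotp (pi a x) y = dotp x (pi (cstar a) y)
}.

Definition faithful_representation (pi : A -> H -> H) : Prop :=
  is_representation pi /\ injective pi.

End Operators.

Section HaarMeasure.
Variables (G : topologicalGroupType) (R : realType).

Definition borel := g_sigma_algebraType (@open G).

Record left_haar_measure (mu : {measure set borel -> \bar R}) : Prop :=
  LeftHaarMeasure {
  haar_neq0 : mu setT <> 0%E;
  haar_left_invariant : forall (x : G) (E : set G),
    measurable (E : set borel) -> mu [set (x * y)%g | y in E] = mu E;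
  haar_compact : forall K : set G, compact K -> (mu K < +oo)%E;
  haar_outer : forall E : set G, measurable (E : set borel) ->
    mu E = ereal_inf [set mu U | U in [set U : set G | open U /\ E `<=` U]];
  haar_inner : forall U : set G, open U ->
    mu U = ereal_sup [set mu K | K in [set K : set G | compact K /\ K `<=` U]]
}.

Definition cintegral (mu : {measure set borel -> \bar R}) (f : G -> R[i])
    : R[i] :=
  Complex (Rintegral mu setT (fun t => complex.Re (f t)))
          (Rintegral mu setT (fun t => complex.Im (f t))).

End HaarMeasure.

Definition Cc (G : topologicalType) (K : numFieldType) (V : normedModType K)
    (f : G -> V) : Prop :=
  continuous f /\ compact (closure [set t | f t != 0]).

(* L together with iota is L^2(G, H): the completion of the continuous
   compactly supported functions for the L^2 inner product. The values of iota
   outside of Cc are irrelevant. *)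
Record is_L2 (G : topologicalGroupType) (R : realType)
    (mu : {measure set (borel G) -> \bar R}) (H L : hilbertType R)
    (iota : (G -> H) -> L) : Prop := IsL2 {
  L2_linear : forall (z : R[i]) (xi eta : G -> H), Cc xi -> Cc eta ->
    iota (fun t => z *: xi t + eta t) = z *: iota xi + iota eta;
  L2_dotp : forall xi eta : G -> H, Cc xi -> Cc eta ->
    dotp (iota xi) (iota eta) = cintegral mu (fun t => dotp (xi t) (eta t));
  L2_dense : forall (k : L) (e : R[i]), 0 < e ->
    exists2 xi : G -> H, Cc xi & `|k - iota xi| < e
}.

Section CrossedProduct.
Variables (G : topologicalGroupType) (R : realType) (A : cstarAlgType R).
Variables (H L : hilbertType R).

(* Bounded operators on L are determined by their values on Cc(G, H). *)
Definition is_regular_representation (alpha : G -> A -> A) (pi : A -> H -> H)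
    (iota : (G -> H) -> L) (tpi : A -> L -> L) : Prop :=
  forall a, bounded_operator (tpi a) /\
    forall xi : G -> H, Cc xi ->
      tpi a (iota xi) = iota (fun t => pi (alpha (t^-1)%g a) (xi t)).

Definition is_left_translation (iota : (G -> H) -> L) (lam : G -> L -> L)
    : Prop :=
  forall s, bounded_operator (lam s) /\
    forall xi : G -> H, Cc xi ->
      lam s (iota xi) = iota (fun t => xi (s^-1 * t)%g).

(* X = \int f(s) tpi(a) lam_s ds, the integral being understood weakly. *)
Definition crossed_product_generator (mu : {measure set (borel G) -> \bar R})
    (tpi : A -> L -> L) (lam : G -> L -> L) (X : L -> L) : Prop :=
  bounded_operator X /\
  exists (f : G -> R[i]) (a : A), Cc (f : G -> R[i]^o) /\
    forall k k' : L,
      dotp (X k) k' = cintegral mu (fun s => f s * dotp (tpi a (lam s k)) k').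

End CrossedProduct.

(* B is the C*-algebra A x_{alpha,r} G: for some faithful representation pi of
   A, rho identifies B isometrically with the closed linear span of the
   generators, a C*-algebra of operators on L = L^2(G, H). *)
Definition is_reduced_crossed_product (G : topologicalGroupType)
    (R : realType) (A : cstarAlgType R) (alpha : G -> A -> A)
    (B : cstarAlgType R) : Prop :=
  exists (mu : {measure set (borel G) -> \bar R}) (H L : hilbertType R)
    (pi : A -> H -> H) (iota : (G -> H) -> L)
    (tpi : A -> L -> L) (lam : G -> L -> L) (rho : B -> L -> L),
    [/\ left_haar_measure mu, faithful_representation pi, is_L2 mu iota,
        is_regular_representation alpha pi iota tpi &
        is_left_translation iota lam] /\
    [/\ is_representation rho,
        forall b, is_opnorm (rho b) `|b| &
        range rho = closed_span (crossed_product_generator mu tpi lam)].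

(* Main.v *)
(* Write V xi = f (x) xi for a bump function f near the unit with int f^2 = 1,
   and C = int h(s) lambda_s ds for a bump function h near the unit with
   int h = 1.
   Then S a = tpi(a) C lies in the crossed product, V^* x V lies in pi(A) for
   every x in the crossed product, and T x = pi^-1 (V^* x V). Both maps are
   completely contractive because V is an isometry and C is a contraction, and
   T (S a) is an average of the elements f(t) f(s^-1 t) alpha_{t^-1}(a) over s
   and t near the unit, hence close to a.

   Faithful representations have to be isometric on every M_n(A), which has only
   one complete C*-norm. A star-representation phi is contractive because
   b = a^* a with |a| < 1 can be written 2 c - c^2 with c = c^*, so that
   |xi|^2 - |phi(a) xi|^2 = |xi - phi(c) xi|^2. Conversely, if M <= N are
   C*-norms and N is complete, every self-adjoint x with M x small is M-close to
   the imaginary part of a unitary, hence to an element with bounded N-norm;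
   iterating, N <= K M on self-adjoint elements, and then N <= M by taking
   powers. *)

From HB Require Import structures.
Require Import Defs.
From mathcomp Require Import all_boot all_order all_algebra.
From mathcomp Require Import all_classical all_reals all_analysis.
From mathcomp Require Import complex measurable_realfun.
From mathcomp Require Import ring lra.

Set Implicit Arguments.
Unset Strict Implicit.
Unset Printing Implicit Defensive.

Import Order.TTheory GRing.Theory Num.Theory.
Import numFieldNormedType.Exports.

Local Open Scope classical_set_scope.
Local Open Scope ring_scope.
Local Open Scope complex_scope.

Local Notation Re := complex.Re.
Local Notation Im := complex.Im.

(** [cstar_mxnorm] is a choice among the norms that make a matrix algebra a C*-algebra, so nothing
    can be computed with it before such a norm is known to exist and to be unique. Existence needs a
    faithful representation: [pi] serves for [A] and [rho] for the crossed product, and both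
    complete contractions are then estimated on vectors.

    Neither a unit nor spectral theory is used. The square root is the fixed point of an iteration,
    and [1 + w] is handled through [w] alone.

    Compressions stay in [pi(A)] because [V^* tpi(a) lambda_s V = pi(b_s)], where [b_s] is the
    integral of [f(t) f(s^-1 t) alpha_{t^-1}(a)] over [t], taken in [A]. To integrate over [s] as
    well, [b_s] has to be norm continuous in [s]. In general [lambda_s] is only strongly continuous,
    but [lambda_s V] is norm continuous: [|lambda_s V x - lambda_r V x|] is [|x|] times the [L^2]
    distance of two translates of the scalar function [f]. The same uniformity in [x] drives the
    final estimate. *)

Section RealNorm.
Variable R : realType.

Definition rnorm (V : normedZmodType R[i]) (x : V) : R := Re `|x|.

Lemma ge0_ReE (z : R[i]) : 0 <= z -> z = (Re z)%:C.
Proof. by case: z => a b; rewrite lecE /= => /andP[/eqP-> _]. Qed.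

Lemma gt0_ReE (z : R[i]) : 0 < z -> z = (Re z)%:C /\ 0 < Re z.
Proof.
by move=> z0; split; [apply/ge0_ReE/ltW | move: z0; rewrite ltcE => /andP[]].
Qed.

Section Zmod.
Variable V : normedZmodType R[i].
Implicit Types x y : V.

Lemma rnormE x : `|x| = (rnorm x)%:C.
Proof. by apply: ge0_ReE; rewrite normr_ge0. Qed.

Lemma rnorm_ge0 x : 0 <= rnorm x.
Proof. by rewrite -lecR -rnormE rmorph0 normr_ge0. Qed.

Lemma rnormD x y : rnorm (x + y) <= rnorm x + rnorm y.
Proof. by rewrite -lecR rmorphD /= -!rnormE ler_normD. Qed.

Lemma rnormN x : rnorm (- x) = rnorm x.
Proof. by rewrite /rnorm normrN. Qed.

Lemma rnormB x y : rnorm (x - y) <= rnorm x + rnorm y.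
Proof. by rewrite -(rnormN y) rnormD. Qed.

Lemma rnormBC x y : rnorm (x - y) = rnorm (y - x).
Proof. by rewrite -opprB rnormN. Qed.

Lemma rnorm0 : rnorm (0 : V) = 0.
Proof. by rewrite /rnorm normr0. Qed.

Lemma rnorm0_eq0 x : rnorm x = 0 -> x = 0.
Proof. by move=> x0; apply/normr0_eq0; rewrite rnormE x0. Qed.

Lemma rnorm_lt x (e : R) : (`|x| < e%:C) = (rnorm x < e).
Proof. by rewrite rnormE ltcR. Qed.

End Zmod.

Lemma rnormM (z t : R[i]) : rnorm (z * t) = rnorm z * rnorm t.
Proof. by apply: complexI; rewrite rmorphM /= -!rnormE normrM. Qed.

Lemma rnormZ (V : normedModType R[i]) (z : R[i]) (x : V) :
  rnorm (z *: x) = rnorm z * rnorm x.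
Proof. by apply: complexI; rewrite rmorphM /= -!rnormE normrZ. Qed.

Lemma rnormR (t : R) : rnorm (t%:C) = `|t|.
Proof. by rewrite /rnorm normc_def /= expr0n /= addr0 sqrtr_sqr. Qed.

Lemma rnorm_i : rnorm ('i : R[i]) = 1.
Proof. by rewrite /rnorm normc_def /= expr0n add0r expr1n sqrtr1. Qed.

Lemma rnorm_sqr (z : R[i]) : rnorm z ^+ 2 = Re z ^+ 2 + Im z ^+ 2.
Proof. by rewrite /rnorm normc_def /= sqr_sqrtr // addr_ge0 // sqr_ge0. Qed.

(** Serves as the passage to the limit for the iterations below: a norm is shown to vanish by
    bounding it by the error after [n] steps. *)
Lemma le0_geometric (x K q : R) : 0 <= q < 1 ->
  (forall n, x <= K * q ^+ n) -> x <= 0.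
Proof.
move=> /andP[q0 q1] xK.
have cv : (fun n => K * q ^+ n) @ \oo --> (K * 0 : R).
  by apply: cvgMr; apply: cvg_expr; rewrite ger0_norm.
rewrite leNgt; apply/negP => x0.
have /cvgr_dist_lt/(_ _ x0)[n _ /(_ n (leqnn n))] := cv.
rewrite /= mulr0 sub0r normrN => lt_x.
by have := le_lt_trans (ler_norm _) lt_x; rewrite ltNge xK.
Qed.

Lemma geometric_small (K q e : R) : 0 <= q < 1 -> 0 < e ->
  exists n, K * q ^+ n < e.
Proof.
move=> q01 e0; apply: contrapT => /forallNP H.
suff : e <= 0 by rewrite leNgt e0.
by apply: (@le0_geometric e K q) => // n; rewrite leNgt; apply/negP/H.
Qed.

End RealNorm.

(** * Norms on star-algebras *)

Section StarAlgebra.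
Variables (R : realType) (V : lmodType R[i]).

(* The operations and the norm are parameters because [M_n(A)] carries several
   candidate norms. *)
Record star_algebra (mul : V -> V -> V) (star : V -> V) : Prop := StarAlgebra {
  starmulA : forall a b c, mul a (mul b c) = mul (mul a b) c;
  starmul_linearl : forall (z : R[i]) a b c,
    mul (z *: a + b) c = z *: mul a c + mul b c;
  starmul_linearr : forall (z : R[i]) a b c,
    mul c (z *: a + b) = z *: mul c a + mul c b;
  starstarK : forall a, star (star a) = a;
  starstar_semilinear : forall (z : R[i]) a b,
    star (z *: a + b) = (z^*)%R *: star a + star b;
  starstarM : forall a b, star (mul a b) = mul (star b) (star a)
}.

Record is_cstar_norm (mul : V -> V -> V) (star : V -> V) (N : V -> R) : Prop :=
  CStarNorm {
  cnorm_ge0 : forall x, 0 <= N x;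
  cnorm0_eq0 : forall x, N x = 0 -> x = 0;
  cnormD : forall x y, N (x + y) <= N x + N y;
  cnormZ : forall (z : R[i]) x, N (z *: x) = rnorm z * N x;
  cnormM : forall x y, N (mul x y) <= N x * N y;
  cnorm_star : forall x, N (mul (star x) x) = N x ^+ 2
}.

(** Kept apart from [is_cstar_norm] because the uniqueness theorem compares a complete norm with one
    whose completeness is not known beforehand. *)
Definition norm_complete (N : V -> R) : Prop :=
  forall u : nat -> V,
    (forall e : R, 0 < e ->
       exists m, forall i j, (m <= i)%N -> (m <= j)%N -> N (u i - u j) < e) ->
    exists l, forall e : R, 0 < e ->
       exists m, forall i, (m <= i)%N -> N (u i - l) < e.

Variables (mul : V -> V -> V) (star : V -> V).
Hypothesis alg : star_algebra mul star.
Local Infix "**" := mul (at level 40, left associativity).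

Lemma starmulDl a b c : (a + b) ** c = a ** c + b ** c.
Proof. by have := starmul_linearl alg 1 a b c; rewrite !scale1r. Qed.

Lemma starmulDr a b c : c ** (a + b) = c ** a + c ** b.
Proof. by have := starmul_linearr alg 1 a b c; rewrite !scale1r. Qed.

Lemma starmul0r c : 0 ** c = 0.
Proof. by apply: (@addrI _ (0 ** c)); rewrite -starmulDl !addr0. Qed.

Lemma starmulr0 c : c ** 0 = 0.
Proof. by apply: (@addrI _ (c ** 0)); rewrite -starmulDr !addr0. Qed.

Lemma starmulZl (z : R[i]) a c : (z *: a) ** c = z *: (a ** c).
Proof.
by have := starmul_linearl alg z a 0 c; rewrite starmul0r !addr0.
Qed.

Lemma starmulZr (z : R[i]) a c : c ** (z *: a) = z *: (c ** a).
Proof.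
by have := starmul_linearr alg z a 0 c; rewrite starmulr0 !addr0.
Qed.

Lemma starmulNl a c : (- a) ** c = - (a ** c).
Proof. by rewrite -scaleN1r starmulZl scaleN1r. Qed.

Lemma starmulNr a c : c ** (- a) = - (c ** a).
Proof. by rewrite -scaleN1r starmulZr scaleN1r. Qed.

Lemma starstarD a b : star (a + b) = star a + star b.
Proof.
have := starstar_semilinear alg 1 a b.
by rewrite rmorph1 !scale1r.
Qed.

Lemma starstar0 : star 0 = 0.
Proof. by apply: (@addrI _ (star 0)); rewrite -starstarD !addr0. Qed.

Lemma starstarZ (z : R[i]) a : star (z *: a) = (z^*)%R *: star a.
Proof.
by have := starstar_semilinear alg z a 0; rewrite starstar0 !addr0.
Qed.

Lemma starstarN a : star (- a) = - star a.
Proof. by rewrite -scaleN1r starstarZ rmorphN1 scaleN1r. Qed.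

Section Norm.
Variable N : V -> R.
Hypothesis hN : is_cstar_norm mul star N.

Lemma cnorm0 : N 0 = 0.
Proof. by rewrite -(scale0r (0 : V)) (cnormZ hN) rnorm0 mul0r. Qed.

Lemma cnormN x : N (- x) = N x.
Proof. by rewrite -scaleN1r (cnormZ hN) rnormN rnormR normr1 mul1r. Qed.

Lemma cnormB x y : N (x - y) <= N x + N y.
Proof. by rewrite -(cnormN y) (cnormD hN). Qed.

Lemma cnormBC x y : N (x - y) = N (y - x).
Proof. by rewrite -opprB cnormN. Qed.

Lemma cnorm_starE x : N (star x) = N x.
Proof.
suff le y : N y <= N (star y).
  by apply: le_anti; rewrite le andbT -{2}(starstarK alg x) le.
have [->|Ny0] := eqVneq (N y) 0; first exact: cnorm_ge0 hN _.
have Ny : 0 < N y by rewrite lt_def Ny0 (cnorm_ge0 hN).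
rewrite -(ler_pM2r Ny) -expr2 -(cnorm_star hN).
exact: cnormM hN _ _.
Qed.

Lemma geometric_limit (u : nat -> V) (K q : R) : norm_complete N ->
  0 <= K -> 0 <= q < 1 ->
  (forall n, N (u n.+1 - u n) <= K * q ^+ n) ->
  exists l, forall n, N (u n - l) <= K / (1 - q) * q ^+ n.
Proof.
move=> cN K0 /andP[q0 q1] Nu.
have q1' : 0 < 1 - q by rewrite subr_gt0.
have step n k : N (u (n + k)%N - u n) <= K / (1 - q) * q ^+ n.
  (* The exact partial sum of the geometric series makes the induction on [k] close. *)
  suff : N (u (n + k)%N - u n) <= K / (1 - q) * q ^+ n * (1 - q ^+ k).
    move/le_trans; apply; rewrite ler_piMr //.
      by rewrite !mulr_ge0 ?exprn_ge0 // invr_ge0 ltW.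
    by rewrite gerBl exprn_ge0.
  elim: k => [|k IH]; first by rewrite addn0 subrr cnorm0 subrr mulr0.
  rewrite addnS -(subrKA (u (n + k)%N)).
  apply: le_trans (cnormD hN _ _) _.
  apply: le_trans (lerD (Nu _) IH) _.
  rewrite exprD exprS le_eqVlt; apply/orP; left; apply/eqP.
  by field; rewrite gt_eqF.
have q01 : 0 <= q < 1 by rewrite q0.
have small e : 0 < e -> exists n, K / (1 - q) * q ^+ n < e.
  by move=> e0; exact: geometric_small.
have dist n m : (n <= m)%N -> N (u m - u n) <= K / (1 - q) * q ^+ n.
  by move=> nm; have := step n (m - n)%N; rewrite subnKC.
have [|l ul] := cN u.
  move=> e e0; have [|n Hn] := small (e / 2); first by rewrite divr_gt0.
  exists n => i j ni nj; rewrite -(subrKA (u n)).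
  apply: le_lt_trans (cnormD hN _ _) _; rewrite (cnormBC (u n)).
  have := dist _ _ ni; have := dist _ _ nj; lra.
exists l => n; rewrite leNgt; apply/negP => lt.
have [|m Hm] := ul (N (u n - l) - K / (1 - q) * q ^+ n).
  by rewrite subr_gt0.
pose k := maxn m n.
have := Hm k (leq_maxl _ _); have := dist n k (leq_maxr _ _).
have := cnormD hN (u n - u k) (u k - l); rewrite subrKA (cnormBC (u n) (u k)).
lra.
Qed.

(* [c] is [1 - sqrt (1 - b)]. *)
Lemma one_sub_sqrt (b : V) (q : R) : norm_complete N -> N b <= q -> q < 1 ->
  exists c, [/\ c + c = b + c ** c, N c <= q,
    forall d, b ** d = d ** b -> c ** d = d ** c &
    star b = b -> star c = c].
Proof.
move=> cN Nb q1.
have q0 : 0 <= q by apply: le_trans Nb; exact: cnorm_ge0 hN _.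
pose h : R[i] := (2^-1 : R)%:C.
have h2 (x : V) : h *: x + h *: x = x.
  rewrite -scalerDl -rmorphD /= -[RHS]scale1r; congr (_ *: _).
  by have -> : (2^-1 + 2^-1 : R) = 1 by lra.
have Nh x : N (h *: x) = N x / 2.
  by rewrite (cnormZ hN) rnormR ger0_norm ?invr_ge0 // mulrC.
(* The equation [2 c = b + c^2] is solved by iterating [f] from 0. On the ball of radius [q] the map
   [f] contracts by the factor [q], because [f x - f y] is half of [x (x - y) + (x - y) y]. *)
pose f c := h *: (b + c ** c).
have fB x y : f x - f y = h *: (x ** (x - y) + (x - y) ** y).
  rewrite /f -scalerBr; congr (_ *: _).
  rewrite starmulDr starmulDl starmulNr starmulNl addrA subrK.
  by rewrite opprD addrACA subrr add0r.
pose u n := iter n f 0.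
have Nu n : N (u n) <= q.
  elim: n => [|n IH] /=; first by rewrite cnorm0.
  rewrite Nh.
  have := cnormD hN b (u n ** u n).
  have := cnormM hN (u n) (u n).
  have := cnorm_ge0 hN (u n) => ? ? ?.
  have : N (u n) * N (u n) <= q * 1 by apply: ler_pM => //; lra.
  lra.
have Nu1 n : N (u n.+1 - u n) <= 1 * q ^+ n.
  elim: n => [|n IH].
    rewrite /= subr0 Nh starmul0r addr0 expr0; lra.
  rewrite [_ - _](fB (u n.+1) (u n)).
  rewrite Nh ler_pdivrMr //.
  apply: le_trans (cnormD hN _ _) _.
  have le1 := cnormM hN (u n.+1) (u n.+1 - u n).
  have le2 := cnormM hN (u n.+1 - u n) (u n).
  have := cnorm_ge0 hN (u n.+1 - u n) => d0.
  have le3 : N (u n.+1) * N (u n.+1 - u n) <= q * (1 * q ^+ n).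
    by apply: ler_pM => //; exact: cnorm_ge0 hN _.
  have le4 : N (u n.+1 - u n) * N (u n) <= (1 * q ^+ n) * q.
    by apply: ler_pM => //; exact: cnorm_ge0 hN _.
  rewrite exprS; lra.
have q01 : 0 <= q < 1 by rewrite q0.
have [c uc] := geometric_limit cN ler01 q01 Nu1.
pose K := 1 / (1 - q).
have K0 : 0 <= K by rewrite /K div1r invr_ge0 subr_ge0 ltW.
have Nc : N c <= q.
  rewrite -subr_le0; apply: (@le0_geometric _ _ K q) => // n.
  have := uc n; have := Nu n; have := cnormB (u n) (u n - c).
  rewrite subKr -/K; lra.
(* Every property of the iterates passes to [c] in this way: the defect at [c] is bounded by a
   multiple of the distance from [u n] to [c]. *)
have eqlim (x : V) (C : R) : (forall n, N x <= C * (K * q ^+ n)) -> x = 0.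
  move=> Nx; apply: (cnorm0_eq0 hN); apply/eqP.
  rewrite eq_le (cnorm_ge0 hN) andbT.
  by apply: (@le0_geometric _ _ (C * K) q) => // n; rewrite -mulrA.
exists c; split => //.
- suff {1 2}-> : c = f c by rewrite h2.
  apply/eqP; rewrite -subr_eq0; apply/eqP/(eqlim _ 2) => n.
  rewrite -(subrKA (u n.+1)) [X in _ + X](fB (u n) c).
  apply: le_trans (cnormD hN _ _) _; rewrite Nh.
  have le1 := cnormM hN (u n) (u n - c).
  have le2 := cnormM hN (u n - c) c.
  have le3 := cnormD hN (u n ** (u n - c)) ((u n - c) ** c).
  have d0 := cnorm_ge0 hN (u n - c).
  have le4 : N (u n) * N (u n - c) <= 1 * N (u n - c).
    by apply: ler_wpM2r => //; apply: le_trans (Nu n) _; exact: ltW.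
  have le5 : N (u n - c) * N c <= N (u n - c) * 1.
    by apply: ler_wpM2l => //; apply: le_trans Nc _; exact: ltW.
  have := uc n.+1; have := uc n; rewrite -/K (cnormBC c).
  have : K * q ^+ n.+1 <= K * q ^+ n.
    by rewrite ler_wpM2l // exprS ler_piMl ?exprn_ge0 // ltW.
  lra.
- move=> d bd.
  have ud n : u n ** d = d ** u n.
    elim: n => [|n IH]; first by rewrite /= starmul0r starmulr0.
    rewrite [u n.+1]/= /f starmulZl starmulZr starmulDl starmulDr bd.
    by rewrite -(starmulA alg) IH !(starmulA alg) IH.
  apply/eqP; rewrite -subr_eq0; apply/eqP/(eqlim _ (2 * N d)) => n.
  have -> : c ** d - d ** c = d ** (u n - c) - (u n - c) ** d.
    rewrite starmulDl starmulDr !starmulNl !starmulNr ud opprD opprK.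
    by rewrite addrACA subrr add0r addrC.
  apply: le_trans (cnormB _ _) _.
  have le1 := cnormM hN d (u n - c).
  have le2 := cnormM hN (u n - c) d.
  have le3 : N d * N (u n - c) <= N d * (K * q ^+ n).
    by apply: ler_wpM2l; [exact: cnorm_ge0 hN _|exact: uc].
  lra.
- move=> sb.
  have su n : star (u n) = u n.
    elim: n => [|n IH]; first by rewrite /= starstar0.
    rewrite [u n.+1]/= /f starstarZ starstarD (starstarM alg) sb IH.
    by congr (_ *: _); exact: conjc_real.
  apply/eqP; rewrite -subr_eq0; apply/eqP/(eqlim _ 2) => n.
  have -> : star c - c = (u n - c) - star (u n - c).
    by rewrite starstarD starstarN su opprD opprK addrACA subrr add0r addrC.
  apply: le_trans (cnormB _ _) _; rewrite cnorm_starE.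
  have := uc n; rewrite -/K; lra.
Qed.

End Norm.
End StarAlgebra.

Section RealForm.
Variables (R : realType) (W : lmodType R[i]).

(** Models the real part of a complex inner product, possibly degenerate. Real values suffice for
    adjoints and Cauchy-Schwarz, and [rformU] retains what is needed of complex scalars. Such forms
    add up over coordinates, so [H^n] can be used without being made a Hilbert space. *)
Record real_form (p : W -> W -> R) : Prop := RealForm {
  rformDl : forall x y z, p (x + y) z = p x z + p y z;
  rformZl : forall (t : R) x y, p (t%:C *: x) y = t * p x y;
  rformC : forall x y, p x y = p y x;
  rform_ge0 : forall x, 0 <= p x x;
  rformU : forall (z : R[i]) x, p (z *: x) (z *: x) = rnorm z ^+ 2 * p x x
}.

Variable p : W -> W -> R.
Hypothesis hp : real_form p.

Definition form_norm x := Num.sqrt (p x x).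
Local Notation P := form_norm.

Lemma rformDr x y z : p x (y + z) = p x y + p x z.
Proof. by rewrite (rformC hp) (rformDl hp) !(rformC hp x). Qed.

Lemma rformZr (t : R) x y : p x (t%:C *: y) = t * p x y.
Proof. by rewrite (rformC hp) (rformZl hp) (rformC hp x). Qed.

Lemma rformNl x y : p (- x) y = - p x y.
Proof. by rewrite -scaleN1r -(rmorphN1 (real_complex R)) (rformZl hp) mulN1r.
  Qed.

Lemma rformNr x y : p x (- y) = - p x y.
Proof. by rewrite (rformC hp) rformNl (rformC hp x). Qed.

Lemma form_norm_sqr x : P x ^+ 2 = p x x.
Proof. by rewrite sqr_sqrtr // (rform_ge0 hp). Qed.

Lemma form_norm_ge0 x : 0 <= P x.
Proof. exact: sqrtr_ge0. Qed.

Lemma form_norm_le x y (c : R) : 0 <= c ->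
  (P x <= c * P y) = (p x x <= c ^+ 2 * p y y).
Proof.
move=> c0; rewrite -!form_norm_sqr -exprMn ler_pXn2r //.
  by rewrite nnegrE form_norm_ge0.
by rewrite nnegrE mulr_ge0 // form_norm_ge0.
Qed.

Lemma form_cauchy_schwarz_sqr x y : p x y ^+ 2 <= p x x * p y y.
Proof.
have expand (s t : R) : 0 <=
  s ^+ 2 * p x x + 2 * (s * t * p x y) + t ^+ 2 * p y y.
  have := rform_ge0 hp (s%:C *: x + t%:C *: y).
  rewrite (rformDl hp) !rformDr !(rformZl hp) !rformZr (rformC hp y x) => h.
  by apply: le_trans h _; rewrite le_eqVlt; apply/orP; left; apply/eqP; ring.
have [y0|y0] := eqVneq (p y y) 0.
  have [->|xy0] := eqVneq (p x y) 0; first by rewrite expr0n /= y0 mulr0.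
  (* When [p y y = 0] the quadratic polynomial is affine in [t], and this [t] gives it the value
     -1. *)
  have := expand (- 1) ((p x x + 1) / (2 * p x y)).
  rewrite y0 mulr0 addr0 sqrrN expr1n mul1r.
  have -> : 2 * (-1 * ((p x x + 1) / (2 * p x y)) * p x y) = - (p x x + 1).
    by field.
  lra.
have ypos : 0 < p y y by rewrite lt_def y0 (rform_ge0 hp).
rewrite -(ler_pM2l ypos) -subr_ge0.
apply: le_trans (expand (p y y) (- p x y)) _.
rewrite le_eqVlt; apply/orP; left; apply/eqP; ring.
Qed.

Lemma form_cauchy_schwarz x y : p x y <= P x * P y.
Proof.
apply: le_trans (ler_norm _) _.
rewrite -(@ler_pXn2r _ 2) ?nnegrE ?mulr_ge0 ?form_norm_ge0 //.
by rewrite real_normK ?num_real // exprMn !form_norm_sqr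
  form_cauchy_schwarz_sqr.
Qed.

Lemma form_normD x y : P (x + y) <= P x + P y.
Proof.
rewrite -(@ler_pXn2r _ 2) ?nnegrE ?addr_ge0 ?form_norm_ge0 //.
rewrite sqrrD !form_norm_sqr (rformDl hp) !rformDr (rformC hp y x).
have := form_cauchy_schwarz x y; lra.
Qed.

Lemma form_normZ (z : R[i]) x : P (z *: x) = rnorm z * P x.
Proof.
by rewrite /form_norm (rformU hp) sqrtrM ?sqr_ge0 // sqrtr_sqr ger0_norm
  ?rnorm_ge0.
Qed.

End RealForm.

(** * Star-representations and their operator norms *)

Section Representation.
Variables (R : realType) (V W : lmodType R[i]).
Variables (mul : V -> V -> V) (star : V -> V) (p : W -> W -> R).
Hypothesis alg : star_algebra mul star.
Hypothesis hp : real_form p.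
Local Notation P := (form_norm p).

Record star_rep (phi : V -> W -> W) : Prop := StarRep {
  srepD : forall a b x, phi (a + b) x = phi a x + phi b x;
  srepZ : forall (z : R[i]) a x, phi (z *: a) x = z *: phi a x;
  srepM : forall a b x, phi (mul a b) x = phi a (phi b x);
  srep_star : forall a x y, p (phi a x) y = p x (phi (star a) y)
}.

Variable phi : V -> W -> W.
Hypothesis hphi : star_rep phi.

(* If [a^* a = 2 c - c^2] with [c = c^*], then
   [|phi a x|^2 = |x|^2 - |x - phi c x|^2]. *)
Lemma star_rep_contractive (N : V -> R) : is_cstar_norm mul star N ->
  norm_complete N -> forall a x, P (phi a x) <= N a * P x.
Proof.
move=> hN cN.
have lt1 a x : N a < 1 -> p (phi a x) (phi a x) <= p x x.
  move=> Na.
  have Na0 := cnorm_ge0 hN a.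
  have [||c [cc _ _ sc]] := @one_sub_sqrt _ _ _ _ alg N hN
      (mul (star a) a) (N a) cN.
  - by rewrite (cnorm_star hN) expr2 ler_piMl // ltW.
  - exact: Na.
  have {}sc : star c = c by apply: sc; rewrite (starstarM alg) (starstarK alg).
  rewrite (srep_star hphi) -(srepM hphi).
  have -> : mul (star a) a = c + c - mul c c by rewrite cc addrK.
  have -> : p x (phi (c + c - mul c c) x) =
      p x x - p (x - phi c x) (x - phi c x).
    rewrite -scaleN1r !(srepD hphi) (srepZ hphi) scaleN1r (srepM hphi).
    rewrite !(rformDl hp) !(rformDr hp) !(rformNl hp) !(rformNr hp).
    have -> : p x (phi c (phi c x)) = p (phi c x) (phi c x).
      by rewrite [RHS](srep_star hphi) sc.
    by rewrite (rformC hp (phi c x) x); ring.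
  by rewrite gerBl (rform_ge0 hp).
move=> a x; rewrite leNgt; apply/negP => lt.
have x0 : 0 < P x.
  rewrite lt_def (form_norm_ge0 p) andbT; apply/negP => /eqP x0.
  have := lt; rewrite x0 mulr0 ltNge => /negP; apply.
  (* A vector of seminorm 0 must be mapped to one of seminorm 0: this follows from the case of norm
     below 1, applied to [a / t]. *)
  pose t := N a + 1.
  have t0 : 0 < t by rewrite ltr_wpDl // (cnorm_ge0 hN).
  have := lt1 ((t^-1)%:C *: a) x.
  rewrite (cnormZ hN) rnormR gtr0_norm ?invr_gt0 // mulrC ltr_pdivrMr // mul1r.
  rewrite ltrDl ltr01 => /(_ isT).
  rewrite -!(form_norm_sqr hp) x0 expr0n /= (srepZ hphi) (form_normZ hp).
  rewrite rnormR gtr0_norm ?invr_gt0 // => le0.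
  have : (t^-1 * P (phi a x)) ^+ 2 == 0 by rewrite eq_le le0 sqr_ge0.
  by rewrite sqrf_eq0 mulf_eq0 invr_eq0 gt_eqF //= => /eqP ->.
have Na0 := cnorm_ge0 hN a.
pose t := P (phi a x) / P x.
have at_ : N a < t by rewrite /t ltr_pdivlMr.
have t0 : 0 < t by exact: le_lt_trans Na0 at_.
(* With [s] strictly between [N a] and the supposed larger ratio [t], the element [a / s] has norm
   below 1, which forces [t <= s]. *)
pose s := (N a + t) / 2.
have s0 : 0 < s by rewrite /s; lra.
have := lt1 ((s^-1)%:C *: a) x.
rewrite (cnormZ hN) rnormR gtr0_norm ?invr_gt0 // mulrC ltr_pdivrMr // mul1r.
have -> : N a < s by rewrite /s; lra.
move=> /(_ isT); rewrite (srepZ hphi) -[leRHS]mul1r -(expr1n _ 2).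
rewrite -(form_norm_le hp) // (form_normZ hp) rnormR gtr0_norm ?invr_gt0 //.
rewrite mul1r mulrC ler_pdivrMr // mulrC -ler_pdivrMr // -/t /s; lra.
Qed.

Definition op_norm (a : V) : R :=
  inf [set c : R | 0 <= c /\ forall x, P (phi a x) <= c * P x].

Hypothesis phi_bounded : forall a, exists2 c : R, 0 <= c &
  forall x, P (phi a x) <= c * P x.

Lemma op_norm_le a (c : R) : 0 <= c -> (forall x, P (phi a x) <= c * P x) ->
  op_norm a <= c.
Proof. by move=> c0 ac; apply: ge_inf => //; exists 0 => ? []. Qed.

Lemma op_norm_ge0 a : 0 <= op_norm a.
Proof.
have [c c0 ac] := phi_bounded a.
by apply: lb_le_inf; [exists c | move=> ? []].
Qed.

Lemma op_norm_bound a x : P (phi a x) <= op_norm a * P x.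
Proof.
have [c c0 ac] := phi_bounded a.
have [x0|x0] := eqVneq (P x) 0.
  by have := ac x; rewrite x0 !mulr0.
have Px : 0 < P x by rewrite lt_def x0 form_norm_ge0.
rewrite -ler_pdivrMr //; apply: lb_le_inf; first by exists c.
by move=> d [d0 /(_ x)]; rewrite ler_pdivrMr.
Qed.

(** The C*-identity is Cauchy-Schwarz applied to [p (phi a x) (phi a x) = p x (phi (mul (star a) a)
    x)]. Faithfulness is expressed by seminorms since [p] may be degenerate. *)
Lemma op_norm_cstar_norm :
  (forall a, (forall x, P (phi a x) = 0) -> a = 0) ->
  is_cstar_norm mul star op_norm.
Proof.
move=> inj_phi.
have bound0 := form_norm_ge0 p.
have normM a b : op_norm (mul a b) <= op_norm a * op_norm b.
  apply: op_norm_le => [|x]; first by rewrite mulr_ge0 ?op_norm_ge0.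
  rewrite (srepM hphi); apply: le_trans (op_norm_bound _ _) _.
  by rewrite -mulrA ler_wpM2l ?op_norm_ge0 ?op_norm_bound.
have normZ_le (z : R[i]) a : op_norm (z *: a) <= rnorm z * op_norm a.
  apply: op_norm_le => [|x]; first by rewrite mulr_ge0 ?op_norm_ge0 ?rnorm_ge0.
  by rewrite (srepZ hphi) (form_normZ hp) -mulrA ler_wpM2l ?rnorm_ge0
    ?op_norm_bound.
have le_sqr (u v : R) : 0 <= u -> 0 <= v -> u * u <= v * u -> u <= v.
  move=> u0 v0; have [->//|un0] := eqVneq u 0.
  by rewrite ler_pM2r // lt_def un0.
have star_le a : op_norm (star a) <= op_norm a.
  apply: op_norm_le => [|x]; first exact: op_norm_ge0.
  apply: le_sqr => //; first by rewrite mulr_ge0 ?op_norm_ge0.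
  rewrite -expr2 (form_norm_sqr hp) (srep_star hphi) (starstarK alg).
  apply: le_trans (form_cauchy_schwarz hp _ _) _.
  by rewrite mulrC mulrAC ler_wpM2r ?op_norm_bound.
split => //.
- exact: op_norm_ge0.
- move=> a a0; apply: inj_phi => x; apply/eqP.
  by rewrite eq_le bound0 andbT; have := op_norm_bound a x; rewrite a0 mul0r.
- move=> a b; apply: op_norm_le => [|x]; first by rewrite addr_ge0 ?op_norm_ge0.
  rewrite (srepD hphi) mulrDl; apply: le_trans (form_normD hp _ _) _.
  by rewrite lerD ?op_norm_bound.
- move=> z a; apply: le_anti; rewrite normZ_le /=.
  have [->|z0] := eqVneq z 0; first by rewrite rnorm0 mul0r op_norm_ge0.
  have rz0 : 0 < rnorm z.
    by rewrite lt_def rnorm_ge0 andbT; apply: contraNN z0 => /eqP/rnorm0_eq0->.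
  have := normZ_le z^-1 (z *: a).
  rewrite scalerA mulVf // scale1r -(ler_pM2l rz0) mulrA -rnormM divff //.
  by rewrite -[1]/((1 : R)%:C) rnormR normr1 mul1r.
- move=> a; apply: le_anti; apply/andP; split.
    apply: le_trans (normM _ _) _.
    by rewrite expr2 ler_wpM2r ?op_norm_ge0.
  have sq0 := op_norm_ge0 (mul (star a) a).
  rewrite -[leRHS]sqr_sqrtr // ler_pXn2r ?nnegrE ?op_norm_ge0 ?sqrtr_ge0 //.
  apply: op_norm_le => [|x]; first exact: sqrtr_ge0.
  rewrite (form_norm_le hp) ?sqrtr_ge0 // sqr_sqrtr //.
  rewrite (srep_star hphi) -(srepM hphi) -(form_norm_sqr hp) expr2 mulrA.
  apply: le_trans (form_cauchy_schwarz hp _ _) _.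
  by rewrite mulrC ler_wpM2r ?op_norm_bound.
Qed.

End Representation.

(** * Uniqueness of the complete C*-norm *)

Section UniqueNorm.
Variables (R : realType) (V : lmodType R[i]).
Variables (mul : V -> V -> V) (star : V -> V).
Hypothesis alg : star_algebra mul star.
Local Infix "**" := mul (at level 40, left associativity).

(** In the unitization, [(1 + a)(1 + b) = 1 + circ a b]. Working with [circ] avoids adjoining a unit
    and extending two norms to it. *)
Definition circ a b := a + b + a ** b.

Lemma circA a b c : circ (circ a b) c = circ a (circ b c).
Proof.
rewrite /circ !(starmulDl alg) !(starmulDr alg) (starmulA alg) !addrA.
by rewrite [LHS](ACl (1*2*4*6*3*5*7)).
Qed.

Lemma star_circ a b : star (circ a b) = circ (star b) (star a).
Proof.
by rewrite /circ !(starstarD alg) (starstarM alg) [star a + _]addrC.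
Qed.

(* [1 + w] is an isometry in the unitization. *)
Definition quasi_isometry w := circ (star w) w = 0.

Lemma quasi_isometry_circ w : quasi_isometry w -> quasi_isometry (circ w w).
Proof.
move=> w0; rewrite /quasi_isometry star_circ circA -(circA _ w) w0.
by rewrite /circ add0r (starmul0r alg) addr0 -/(circ _ w).
Qed.

(** Since [w^* w = - (w^* + w)], the C*-identity gives [N w ^ 2 <= 2 N w]. The constant is the same
    for all C*-norms, and this is the link between [N] and [M]. *)
Lemma quasi_isometry_norm (N : V -> R) w : is_cstar_norm mul star N ->
  quasi_isometry w -> N w <= 2.
Proof.
move=> hN w0.
have : N w ^+ 2 <= 2 * N w.
  rewrite -(cnorm_star hN) (_ : star w ** w = - (star w + w)).
    rewrite (cnormN hN); apply: le_trans (cnormD hN _ _) _.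
    by rewrite (cnorm_starE alg hN); lra.
  by apply/eqP; rewrite -addr_eq0 addrC; apply/eqP.
have := cnorm_ge0 hN w; have [->//|n0 ge0] := eqVneq (N w) 0.
by rewrite expr2 ler_pM2r // lt_def n0.
Qed.

(** With [c = 1 - sqrt (1 - x^2)], the element [1 + (i x - c)] is [sqrt (1 - x^2) + i x]. As [c] is
    self-adjoint and commutes with [x], its modulus squared is [(1 - c)^2 + x^2 = 1]. *)
Lemma quasi_isometry_small (N : V -> R) x : is_cstar_norm mul star N ->
  norm_complete N -> star x = x -> N x <= 2^-1 ->
  exists c, [/\ quasi_isometry ('i *: x - c), c + c = x ** x + c ** c &
    N c <= 4^-1].
Proof.
move=> hN cN sx Nx.
have Nxx : N (x ** x) <= 4^-1.
  apply: le_trans (cnormM hN _ _) _.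
  have -> : (4^-1 : R) = 2^-1 * 2^-1 by field.
  by apply: ler_pM => //; exact: cnorm_ge0 hN _.
have [|c [cc Nc comc sc]] := one_sub_sqrt alg hN cN Nxx; first by lra.
have xc : c ** x = x ** c by apply: comc; rewrite (starmulA alg).
have {}sc : star c = c by apply: sc; rewrite (starstarM alg) sx.
exists c; split => //; rewrite /quasi_isometry /circ.
rewrite (starstarD alg) (starstarN alg) (starstarZ alg) sx sc.
have -> : ('i^*)%R = - 'i :> R[i] by apply/eqP;
  rewrite eq_complex /= oppr0 !eqxx.
rewrite !(starmulDl alg) !(starmulDr alg) !(starmulNl alg) !(starmulNr alg).
rewrite !(starmulZl alg) !(starmulZr alg) scalerA mulNr -expr2 sqr_i !opprK.
rewrite scale1r xc !scaleNr !opprK.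
set ix := 'i *: x; set ixc := 'i *: (x ** c).
have -> : - ix - c + (ix - c) = - (c + c).
  by rewrite addrACA addNr add0r opprD.
rewrite [X in _ + X](_ : _ = x ** x + c ** c); first by rewrite -cc addNr.
by rewrite addrA [x ** x + ixc - ixc]addrK.
Qed.

Variables N M : V -> R.
Hypotheses (hN : is_cstar_norm mul star N) (cN : norm_complete N).
Hypotheses (hM : is_cstar_norm mul star M) (MN : forall x, M x <= N x).

Lemma cnormZR (t : R) x : 0 <= t -> M (t%:C *: x) = t * M x.
Proof. by move=> t0; rewrite (cnormZ hM) rnormR ger0_norm. Qed.

(* With [x0 = x / 2 ^ m] small, [1 + w] is the [2 ^ m]-th power of the unitary
   [sqrt (1 - x0 ^ 2) + i x0]; thus [N w <= 2] however large [N x] is. *)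
Lemma quasi_isometry_approx x : star x = x -> M x <= 4^-1 ->
  exists w, quasi_isometry w /\ M (w - 'i *: x) <= M x ^+ 2.
Proof.
move=> sx Mx.
have [m Hm] : exists m : nat, N x * 2^-1 ^+ m < 2^-1.
  by apply: geometric_small;
    rewrite ?invr_gt0 // invr_ge0 ler0n invf_lt1 ?ltr1n.
pose x0 := (2^-1 ^+ m)%:C *: x.
have p0 k : (0 : R) <= 2^-1 ^+ k by rewrite exprn_ge0 // invr_ge0.
have sx0 : star x0 = x0.
  by rewrite /x0 (starstarZ alg) sx; congr (_ *: _); exact: conjc_real.
have Nx0 : N x0 <= 2^-1.
  by rewrite /x0 (cnormZ hN) rnormR ger0_norm // mulrC ltW.
have [c [qw cc Nc]] := quasi_isometry_small hN cN sx0 Nx0.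
have Mc : M c <= M x0 ^+ 2.
  have : M (c + c) = 2 * M c.
    by rewrite -cnormZR // -mulr2n -scaler_nat rmorph_nat.
  rewrite cc => e1.
  have := cnormD hM (x0 ** x0) (c ** c).
  have := cnormM hM x0 x0; have := cnormM hM c c.
  have c0 := cnorm_ge0 hM c.
  have : M c * M c <= M c * 4^-1.
    by apply: ler_wpM2l => //; apply: le_trans (MN _) Nc.
  rewrite e1 expr2; have := sqr_ge0 (M x0); rewrite expr2; lra.
(* Each squaring of [1 + w] doubles the first-order term [i x0]. The induction shows that the error
   remains quadratic in that term, measured by [M]. *)
suff: forall k, (k <= m)%N -> exists w, quasi_isometry w /\
    M (w - (2 ^+ k)%:C *: ('i *: x0)) <= (2 ^+ k * M x0) ^+ 2.
  move=> /(_ m (leqnn m)) [w [qw' Mw]]; exists w; split => //.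
  have x0x : (2 ^+ m)%:C *: x0 = x.
    by rewrite scalerA -rmorphM /= -exprMn mulfV ?pnatr_eq0 // expr1n scale1r.
  move: Mw; rewrite scalerA mulrC -scalerA x0x /x0 cnormZR // mulrA -exprMn.
  by rewrite mulfV ?pnatr_eq0 // expr1n mul1r.
elim=> [_|k IH km].
  exists ('i *: x0 - c); split => //.
  by rewrite expr0 scale1r mul1r addrAC subrr add0r (cnormN hM).
have [w [{}qw Mw]] := IH (ltnW km).
exists (circ w w); split; first exact: quasi_isometry_circ.
set y := (2 ^+ k)%:C *: ('i *: x0) in Mw.
have My : M y = 2 ^+ k * M x0.
  by rewrite /y cnormZR ?exprn_ge0 // (cnormZ hM) rnorm_i mul1r.
have My8 : M y <= 8^-1.
  have : 2 * M y <= 4^-1.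
    apply: le_trans Mx; rewrite My mulrA -exprS /x0 cnormZR // mulrA.
    rewrite -[leRHS]mul1r ler_wpM2r ?(cnorm_ge0 hM) //.
    rewrite -(subnKC km) exprD mulrA -exprMn mulfV ?pnatr_eq0 // expr1n mul1r
      exprn_ile1 //.
    by rewrite invf_le1 ?ler1n.
  lra.
have -> : (2 ^+ k.+1)%:C *: ('i *: x0) = y + y.
  by rewrite exprS rmorphM /= -scalerA -/y rmorph_nat scaler_nat mulr2n.
have -> : (2 ^+ k.+1 * M x0) ^+ 2 = 4 * M y ^+ 2 by rewrite My (exprS 2 k);
  ring.
(* From [M y <= 1/8] one gets [M w <= 9/8 * M y], so the new error is at most
   [(2 + 81/64) * M y ^ 2], within the allowed [4 * M y ^ 2]. *)
have -> : circ w w - (y + y) = (w - y) + (w - y) + w ** w.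
  by rewrite /circ opprD !addrA [LHS](ACl (1*4*2*5*3)).
apply: le_trans (cnormD hM _ _) _.
have := cnormD hM (w - y) (w - y).
have := cnormM hM w w.
have := cnormD hM (w - y) y; rewrite subrK => Mw2.
have y0 := cnorm_ge0 hM y; have w0 := cnorm_ge0 hM w.
rewrite -My in Mw.
have : M w * M w <= (9 / 8 * M y) * (9 / 8 * M y).
  have : M w <= 9 / 8 * M y.
    have : M y ^+ 2 <= 8^-1 * M y by rewrite expr2 ler_wpM2r.
    lra.
  by move=> h; apply: ler_pM.
have := sqr_ge0 (M y); rewrite !expr2 in Mw *; lra.
Qed.

(** The approximant is the imaginary part of a quasi-isometry [w] close to [i x]; its [N]-norm
    inherits the bound 2. The scalar [z] is [1 / 2i]. *)
Lemma selfadjoint_approx_small x : star x = x -> M x <= 4^-1 ->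
  exists y, [/\ star y = y, N y <= 2 & M (x - y) <= M x ^+ 2].
Proof.
move=> sx Mx; have [w [qw Mw]] := quasi_isometry_approx sx Mx.
have Nw := quasi_isometry_norm hN qw.
pose z : R[i] := Complex 0 (- 2^-1).
have zJ : (z^*)%R = - z by apply/eqP; rewrite eq_complex /= oppr0 !eqxx.
have zi : z * 'i = (2^-1)%:C.
  by apply/eqP; rewrite eq_complex /=; apply/andP; split; apply/eqP; field.
have rz : rnorm z = 2^-1.
  by rewrite /rnorm normc_def /= expr0n add0r sqrtr_sqr normrN gtr0_norm.
exists (z *: (w - star w)); split.
- rewrite (starstarZ alg) (starstarD alg) (starstarN alg) (starstarK alg) zJ.
  by rewrite scaleNr -scalerN opprD opprK addrC.
- rewrite (cnormZ hN) rz; have := cnormB hN w (star w).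
  rewrite (cnorm_starE alg hN); lra.
- have -> : x - z *: (w - star w) =
      z *: (star (w - 'i *: x) - (w - 'i *: x)).
    rewrite (starstarD alg) (starstarN alg) (starstarZ alg) sx.
    have -> : ('i^*)%R = - 'i :> R[i].
      by apply/eqP; rewrite eq_complex /= oppr0 !eqxx.
    rewrite scaleNr opprK opprB [star w + _]addrC addrACA  [RHS]scalerDr
      [z *: ('i *: x + _)]scalerDr scalerA zi.
    rewrite -scalerDl -rmorphD /= (_ : 2^-1 + 2^-1 = 1 :> R) ?scale1r;
      last by lra.
    by rewrite -scalerN opprB.
  rewrite (cnormZ hM) rz; have := cnormB hM (star (w - 'i *: x)) (w - 'i *: x).
  rewrite (cnorm_starE alg hM); lra.
Qed.

(** Here [y] is the remainder and [x - y] the approximant. Dividing [x] by [4 d] brings its [M]-norm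
    down to [1/4]; scaling back turns the bounds 2 and [1/16] into [8 d] and [d / 4]. *)
Lemma selfadjoint_approx x (d : R) : 0 < d -> star x = x -> M x <= d ->
  exists y, [/\ star y = y, N (x - y) <= 8 * d & M y <= d / 4].
Proof.
move=> d0 sx Mx.
have d40 : 0 < 4 * d by rewrite mulr_gt0.
pose x1 := ((4 * d)^-1)%:C *: x.
have sx1 : star x1 = x1.
  by rewrite /x1 (starstarZ alg) sx; congr (_ *: _); exact: conjc_real.
have Mx1 : M x1 <= 4^-1.
  rewrite /x1 cnormZR; last by rewrite invr_ge0 ltW.
  by rewrite mulrC ler_pdivrMr //; lra.
have [y [sy Ny My]] := selfadjoint_approx_small sx1 Mx1.
have x1x : (4 * d)%:C *: x1 = x.
  by rewrite /x1 scalerA -rmorphM /= mulfV ?gt_eqF // scale1r.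
exists (x - (4 * d)%:C *: y); split.
- rewrite (starstarD alg) (starstarN alg) (starstarZ alg) sx sy.
  by congr (_ - _ *: _); exact: conjc_real.
- rewrite subKr (cnormZ hN) rnormR gtr0_norm //.
  have : 4 * d * N y <= 4 * d * 2 by rewrite ler_pM2l.
  lra.
- rewrite -[in X in M X]x1x -scalerBr cnormZR; last exact: ltW.
  have : M x1 ^+ 2 <= 4^-1 * 4^-1.
    by rewrite expr2; apply: ler_pM => //; exact: cnorm_ge0 hM _.
  move=> h; have : 4 * d * M (x1 - y) <= 4 * d * (4^-1 * 4^-1).
    by rewrite ler_pM2l // (le_trans My).
  lra.
Qed.

(* As in the open mapping theorem, [x] is the sum of a series of elements whose
   [N]-norms decrease geometrically. *)
Lemma selfadjoint_norm_equiv x : star x = x -> N x <= 32 / 3 * M x.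
Proof.
move=> sx; have [Mx0|Mx0] := eqVneq (M x) 0.
  by rewrite (cnorm0_eq0 hM Mx0) (cnorm0 hN) (cnorm0 hM) mulr0.
pose d := M x.
have d0 : 0 < d by rewrite lt_def Mx0 (cnorm_ge0 hM).
have e0 n : 0 < d * 4^-1 ^+ n by rewrite mulr_gt0 // exprn_gt0 // invr_gt0.
(* The next remainder is chosen for all pairs, with the default 0 when the hypotheses fail, so that
   [r] can be defined by recursion before its bounds are proved. *)
have /choice[g gP] (nr : nat * V) : exists y, star nr.2 = nr.2 ->
    M nr.2 <= d * 4^-1 ^+ nr.1 ->
    [/\ star y = y, N (nr.2 - y) <= 8 * (d * 4^-1 ^+ nr.1) &
        M y <= d * 4^-1 ^+ nr.1 / 4].
  have [[s Mr]|] := pselect (star nr.2 = nr.2 /\ M nr.2 <= d * 4^-1 ^+ nr.1).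
    by have [y yP] := selfadjoint_approx (e0 nr.1) s Mr; exists y.
  by move=> h; exists 0 => s Mr; exfalso; apply: h.
pose r := fix r n := if n is k.+1 then g (k, r k) else x.
have rP n : star (r n) = r n /\ M (r n) <= d * 4^-1 ^+ n.
  elim: n => [|n [sr Mr]]; first by rewrite expr0 mulr1.
  have [s _ m] := gP (n, r n) sr Mr; split => //.
  by rewrite exprS mulrCA mulrC.
have Nr n : N ((x - r n.+1) - (x - r n)) <= 8 * d * 4^-1 ^+ n.
  have [sr Mr] := rP n; have [_ + _] := gP (n, r n) sr Mr.
  by rewrite /= mulrA opprB [x - _ + _]addrC subrKA.
have q01 : 0 <= (4^-1 : R) < 1 by rewrite invr_ge0 ler0n invf_lt1 ?ltr1n.
have K0 : 0 <= 8 * d by rewrite mulr_ge0 // ltW.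
have [l ul] := geometric_limit hN cN K0 q01 Nr.
have Nl : N l <= 32 / 3 * d.
  have := ul 0%N; rewrite /= subrr sub0r (cnormN hN) expr0 mulr1 => /le_trans.
  by apply; rewrite le_eqVlt; apply/orP; left; apply/eqP; field.
(* The partial sums [x - r n] tend to [l] for [N], hence for [M], and to [x] for [M]. The constant
   [32 / 3] is [8 / (1 - 1/4)]. *)
suff xl : x = l by rewrite -xl in Nl.
apply/eqP; rewrite -subr_eq0; apply/eqP/(cnorm0_eq0 hM).
apply/le_anti/andP; split; last exact: cnorm_ge0 hM _.
apply: (@le0_geometric _ _ (d + 8 * d / (1 - 4^-1)) 4^-1) => // n.
have -> : x - l = r n + (x - r n - l) by rewrite addrA addrCA subrr addr0.
rewrite mulrDl; apply: le_trans (cnormD hM _ _) _; apply: lerD.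
  by have [] := rP n.
exact: le_trans (MN _) (ul n).
Qed.

(* The constant [32 / 3] disappears by taking the powers [y ^ (2 ^ n)]. *)
Theorem cstar_norm_unique x : N x = M x.
Proof.
suff sa y : star y = y -> N y <= M y.
  apply/le_anti; rewrite MN andbT.
  rewrite -(ler_pXn2r (n := 2)) ?nnegrE ?(cnorm_ge0 hN) ?(cnorm_ge0 hM) //.
  rewrite -(cnorm_star hN) -(cnorm_star hM); apply: sa.
  by rewrite (starstarM alg) (starstarK alg).
move=> sy; rewrite leNgt; apply/negP => lt.
have M0 := cnorm_ge0 hM y.
have N0 : 0 < N y by exact: le_lt_trans M0 lt.
pose u n := iter n (fun a => a ** a) y.
have su n : star (u n) = u n.
  by elim: n => //= n IH; rewrite (starstarM alg) IH.
have pw (Q : V -> R) n : is_cstar_norm mul star Q -> Q (u n) = Q y ^+ (2 ^ n).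
  move=> hQ; elim: n => [|n IH]; first by rewrite expn0 expr1.
  by rewrite /= -{1}su (cnorm_star hQ) IH -exprM expnSr.
pose q := M y / N y.
have q0 : 0 <= q by rewrite divr_ge0 // ltW.
have q1 : q < 1 by rewrite ltr_pdivrMr // mul1r.
suff : (1 : R) <= 0 by rewrite leNgt ltr01.
apply: (@le0_geometric _ _ (32 / 3) q) => [|n]; first by rewrite q0.
have := selfadjoint_norm_equiv (su n); rewrite !pw // => Nn.
apply: (@le_trans _ _ (32 / 3 * q ^+ (2 ^ n))).
  by rewrite /q expr_div_n mulrA ler_pdivlMr ?mul1r // exprn_gt0.
(* By [n < 2 ^ n], the power [q ^ (2 ^ n)] is at most [q ^ n], the form that [le0_geometric]
   accepts. *)
rewrite ler_pM2l ?divr_gt0 // -(subnKC (ltnW (ltn_expl n (ltnSn 1)))) exprD.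
by rewrite ler_piMr ?exprn_ge0 // exprn_ile1 // ltW.
Qed.

End UniqueNorm.

(** * Matrix norms *)

Section AmplifiedForm.
Variables (R : realType) (W : lmodType R[i]) (p : W -> W -> R) (n : nat).
Hypothesis hp : real_form p.

Definition amp_form (x y : {ffun 'I_n -> W}) : R := \sum_i p (x i) (y i).

Lemma amp_real_form : real_form amp_form.
Proof.
split.
- move=> x y z; rewrite /amp_form -big_split /=; apply: eq_bigr => i _.
  by rewrite ffunE (rformDl hp).
- move=> t x y; rewrite /amp_form mulr_sumr; apply: eq_bigr => i _.
  by rewrite ffunE (rformZl hp).
- by move=> x y; apply: eq_bigr => i _; rewrite (rformC hp).
- by move=> x; apply: sumr_ge0 => i _; exact: rform_ge0 hp _.
- move=> z x; rewrite /amp_form mulr_sumr; apply: eq_bigr => i _.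
  by rewrite ffunE (rformU hp).
Qed.

Lemma amp_form_ge (x : {ffun 'I_n -> W}) i :
  form_norm p (x i) <= form_norm amp_form x.
Proof.
apply: ler_wsqrtr; rewrite /amp_form (bigD1 i) //= lerDl.
by apply: sumr_ge0 => j _; exact: rform_ge0 hp _.
Qed.

Lemma amp_form_le (x : {ffun 'I_n -> W}) :
  form_norm amp_form x <= \sum_i form_norm p (x i).
Proof.
have s0 : 0 <= \sum_i form_norm p (x i).
  by apply: sumr_ge0 => i _; exact: form_norm_ge0.
rewrite -(ler_pXn2r (n := 2)) ?nnegrE ?form_norm_ge0 //.
rewrite (form_norm_sqr amp_real_form) expr2 mulr_sumr.
apply: ler_sum => i _; rewrite -(form_norm_sqr hp) expr2 ler_wpM2r
  ?form_norm_ge0 //.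
rewrite (bigD1 i) //= lerDl; apply: sumr_ge0 => j _; exact: form_norm_ge0.
Qed.

End AmplifiedForm.

Section MatrixAlgebra.
Variables (R : realType) (A : cstarAlgType R) (n : nat).

Lemma cstarAlg_star_algebra : star_algebra (@cmul R A) (@cstar R A).
Proof.
split; [exact: cmulA|exact: cmul_linearl|exact: cmul_linearr|exact: cstarK|
  exact: cstar_semilinear|exact: cstarM].
Qed.

Lemma cstarAlg_cstar_norm : is_cstar_norm (@cmul R A) (@cstar R A) (@rnorm R A).
Proof.
split.
- by move=> x; exact: rnorm_ge0.
- by move=> x; exact: rnorm0_eq0.
- by move=> x y; exact: rnormD.
- by move=> z x; exact: rnormZ.
- by move=> x y; rewrite -lecR rmorphM /= -!rnormE; exact: cmul_norm.
- by move=> x; apply: complexI; rewrite rmorphXn /= -!rnormE; exact: cstar_norm.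
Qed.

(* In the library 'M[A]_n has no module structure over R[i], only over the ring
   of its coefficients. *)
Definition mx_alg := 'M[A]_n.

HB.instance Definition _ := GRing.Zmodule.on mx_alg.

Definition mx_scale (z : R[i]) (x : mx_alg) : mx_alg :=
  map_mx (fun a => z *: a) x.

Lemma mx_scaleA (a b : R[i]) (x : mx_alg) :
  mx_scale a (mx_scale b x) = mx_scale (a * b) x.
Proof. by apply/matrixP => i j; rewrite !mxE scalerA. Qed.

Lemma mx_scale1 : left_id 1 mx_scale.
Proof. by move=> x; apply/matrixP => i j; rewrite !mxE scale1r. Qed.

Lemma mx_scaleDr : right_distributive mx_scale +%R.
Proof. by move=> z x y; apply/matrixP => i j; rewrite !mxE scalerDr. Qed.

Lemma mx_scaleDl (x : mx_alg) : {morph mx_scale^~ x : a b / a + b}.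
Proof. by move=> a b; apply/matrixP => i j; rewrite !mxE scalerDl. Qed.

HB.instance Definition _ := GRing.Zmodule_isLmodule.Build R[i] mx_alg
  mx_scaleA mx_scale1 mx_scaleDr mx_scaleDl.

Lemma mx_star_algebra :
  star_algebra (@mx_cmul R A n : mx_alg -> mx_alg -> mx_alg) (@mx_cstar R A n).
Proof.
have alg := cstarAlg_star_algebra.
have mul_suml (F : 'I_n -> A) c : cmul (\sum_i F i) c = \sum_i cmul (F i) c.
  by rewrite (big_morph (cmul^~ c) (id1 := 0) (op1 := +%R)) // => [x y|];
    rewrite ?(starmulDl alg) ?(starmul0r alg).
have mul_sumr (F : 'I_n -> A) c : cmul c (\sum_i F i) = \sum_i cmul c (F i).
  by rewrite (big_morph (cmul c) (id1 := 0) (op1 := +%R)) // => [x y|];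
    rewrite ?(starmulDr alg) ?(starmulr0 alg).
have star_sum (F : 'I_n -> A) : cstar (\sum_i F i) = \sum_i cstar (F i).
  by rewrite (big_morph (@cstar R A) (id1 := 0) (op1 := +%R)) // => [x y|];
    rewrite ?(starstarD alg) ?(starstar0 alg).
split.
- move=> a b c; apply/matrixP => i j; rewrite !mxE.
  under eq_bigr do rewrite mxE mul_sumr.
  rewrite exchange_big; apply: eq_bigr => k _ /=.
  by rewrite mxE mul_suml; apply: eq_bigr => l _; exact: cmulA.
- move=> z a b c; apply/matrixP => i j; rewrite !mxE scaler_sumr -big_split.
  by apply: eq_bigr => k _; rewrite !mxE cmul_linearl.
- move=> z a b c; apply/matrixP => i j; rewrite !mxE scaler_sumr -big_split.
  by apply: eq_bigr => k _; rewrite !mxE cmul_linearr.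
- by move=> a; apply/matrixP => i j; rewrite !mxE cstarK.
- by move=> z a b; apply/matrixP => i j; rewrite !mxE cstar_semilinear.
- move=> a b; apply/matrixP => i j; rewrite !mxE star_sum.
  by apply: eq_bigr => k _; rewrite !mxE cstarM.
Qed.

Lemma is_cstar_mxnorm_cstar_norm (N : 'M[A]_n -> R[i]) : is_cstar_mxnorm N ->
  is_cstar_norm (@mx_cmul R A n : mx_alg -> mx_alg -> mx_alg) (@mx_cstar R A n)
    (fun x => Re (N x)).
Proof.
move=> hN; have NE x : N x = (Re (N x))%:C by exact/ge0_ReE/(mxnorm_ge0 hN).
split.
- by move=> x; rewrite -lecR -NE (mxnorm_ge0 hN).
- by move=> x x0; apply: (mxnorm_eq0 hN); rewrite NE x0.
- by move=> x y; rewrite -lecR rmorphD /= -!NE; exact: mxnormD.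
- by move=> z x; apply: complexI; rewrite rmorphM /= -!NE -rnormE;
  exact: mxnormZ.
- by move=> x y; rewrite -lecR rmorphM /= -!NE; exact: mxnormM.
- by move=> x; apply: complexI; rewrite rmorphXn /= -!NE; exact: mxnorm_cstar.
Qed.

Lemma is_cstar_mxnorm_complete (N : 'M[A]_n -> R[i]) : is_cstar_mxnorm N ->
  norm_complete (fun x : mx_alg => Re (N x)).
Proof.
move=> hN; have NE x : N x = (Re (N x))%:C by exact/ge0_ReE/(mxnorm_ge0 hN).
move=> u cu; have [|l ul] := mxnorm_complete hN (u := u).
  move=> e /gt0_ReE[-> e0]; have [m Hm] := cu _ e0.
  by exists m => i j mi mj; rewrite NE ltcR Hm.
exists l => e e0; have [|m Hm] := ul e%:C; first by rewrite ltcR.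
by exists m => i mi; rewrite -ltcR -NE Hm.
Qed.

Lemma cstar_norm_is_cstar_mxnorm (N : mx_alg -> R) :
  is_cstar_norm (@mx_cmul R A n : mx_alg -> mx_alg -> mx_alg) (@mx_cstar R A n)
    N ->
  norm_complete N -> is_cstar_mxnorm (fun x : 'M[A]_n => (N x)%:C).
Proof.
move=> hN cN; split.
- by move=> x; rewrite ler0c (cnorm_ge0 hN).
- by move=> x [] /(cnorm0_eq0 hN).
- by move=> x y; rewrite -rmorphD lecR (cnormD hN).
- by move=> z x; rewrite rnormE -rmorphM -(cnormZ hN).
- by move=> x y; rewrite -rmorphM lecR (cnormM hN).
- by move=> x; rewrite -rmorphXn -(cnorm_star hN).
- move=> u cu; have [|l ul] := cN u.
    move=> e e0; have [|m Hm] := cu e%:C; first by rewrite ltcR.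
    by exists m => i j mi mj; rewrite -ltcR Hm.
  exists l => e /gt0_ReE[-> e0]; have [m Hm] := ul _ e0.
  by exists m => i mi; rewrite ltcR Hm.
Qed.

End MatrixAlgebra.

Section NormedComplete.
Variables (R : realType) (E : completeNormedModType R[i]).

Lemma rnorm_complete : norm_complete (@rnorm R E).
Proof.
move=> u cu.
have cauchy_u : cauchy (u @ \oo).
  apply/cauchyP => e /gt0_ReE[eE e0].
  have [m Hm] := cu _ e0.
  exists (u m); exists m => // k /= mk.
  by rewrite -ball_normE /= eE rnorm_lt Hm.
have cvu : cvg (u @ \oo) by exact: cauchy_cvg.
exists (lim (u @ \oo)) => e e0.
have e0' : (0 : R[i]) < e%:C by rewrite ltcR.
have /cvgr_dist_lt/(_ _ e0')[m _ Hm] := cvu.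
by exists m => i mi; have := Hm i mi; rewrite /= rnorm_lt rnormBC.
Qed.

End NormedComplete.

Section HilbertForm.
Variables (R : realType) (H : hilbertType R).

Lemma dotpDl (x y w : H) : dotp (x + y) w = dotp x w + dotp y w.
Proof. by have := dotp_linearl 1 x y w; rewrite scale1r mul1r. Qed.

Lemma dotp0l (w : H) : dotp 0 w = 0.
Proof. by apply: (@addrI _ (dotp 0 w)); rewrite -dotpDl !addr0. Qed.

Lemma dotpZl (z : R[i]) (x w : H) : dotp (z *: x) w = z * dotp x w.
Proof. by have := dotp_linearl z x 0 w; rewrite dotp0l !addr0. Qed.

Lemma dotpNl (x w : H) : dotp (- x) w = - dotp x w.
Proof. by rewrite -scaleN1r dotpZl mulN1r. Qed.

Lemma dotpDr (x y w : H) : dotp w (x + y) = dotp w x + dotp w y.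
Proof. by rewrite dotpC dotpDl rmorphD /= -!dotpC. Qed.

Lemma dotpZr (z : R[i]) (x w : H) : dotp w (z *: x) = (z^*)%R * dotp w x.
Proof. by rewrite dotpC dotpZl rmorphM /= -!dotpC. Qed.

Lemma dotpNr (x w : H) : dotp w (- x) = - dotp w x.
Proof. by rewrite dotpC dotpNl rmorphN /= -!dotpC. Qed.

Definition re_dotp (x y : H) : R := Re (dotp x y).

Lemma re_dotp_form : real_form re_dotp.
Proof.
have xx (x : H) : re_dotp x x = rnorm x ^+ 2.
  by rewrite /re_dotp dotp_norm rnormE -rmorphXn.
split.
- by move=> x y z; rewrite /re_dotp dotpDl raddfD.
- by move=> t x y; rewrite /re_dotp dotpZl; case: (dotp x y) => a b /=;
  rewrite mul0r subr0.
- by move=> x y; rewrite /re_dotp dotpC; case: (dotp y x).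
- by move=> x; rewrite xx sqr_ge0.
- by move=> z x; rewrite !xx rnormZ exprMn.
Qed.

Lemma form_norm_re_dotp (x : H) : form_norm re_dotp x = rnorm x.
Proof.
by rewrite /form_norm /re_dotp dotp_norm rnormE -rmorphXn /= sqrtr_sqr ger0_norm
  ?rnorm_ge0.
Qed.

Lemma re_dotp_i (x y : H) : re_dotp x ('i *: y) = Im (dotp x y).
Proof.
by rewrite /re_dotp dotpZr; case: (dotp x y) => a b /=;
  rewrite mul0r sub0r mulN1r opprK.
Qed.

End HilbertForm.

(** Replacing [y] by ['i *: y] turns the real part into the imaginary part, so identities between
    complex inner products may be checked on real parts. *)
Lemma eq_dotp (R : realType) (H K : hilbertType R) (x y : H) (x' y' : K) :
  (forall z, re_dotp x (z *: y) = re_dotp x' (z *: y')) -> dotp x y =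
    dotp x' y'.
Proof.
move=> xy; apply/eqP; rewrite eq_complex; apply/andP; split; apply/eqP.
  by have := xy 1; rewrite !scale1r.
by have := xy 'i; rewrite !re_dotp_i.
Qed.


(** * Amplified representations and the norm of [M_n(A)] *)

Section Amplification.
Variables (R : realType) (A : cstarAlgType R).

Lemma representation_star_rep (H : hilbertType R) (pi : A -> H -> H) :
  is_representation pi -> star_rep (@cmul R A) (@cstar R A) (@re_dotp R H) pi.
Proof.
move=> rp.
have piD a b x : pi (a + b) x = pi a x + pi b x.
  by have := rep_linear rp 1 a b x; rewrite !scale1r.
have pi0 x : pi 0 x = 0 by apply: (@addrI _ (pi 0 x)); rewrite -piD !addr0.
split => //.
- by move=> z a x; have := rep_linear rp z a 0 x; rewrite pi0 !addr0.
- exact: repM.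
- by move=> a x y; rewrite /re_dotp (rep_cstar rp).
Qed.

Lemma representation_linear (H : hilbertType R) (pi : A -> H -> H) a :
  is_representation pi -> linear (pi a).
Proof. by move=> rp; have [] := rep_bounded rp a. Qed.

Variables (H : hilbertType R) (pi : A -> H -> H).
Hypothesis rp : is_representation pi.

Let srp := representation_star_rep rp.

Lemma repD a x y : pi a (x + y) = pi a x + pi a y.
Proof. by have := representation_linear a rp 1 x y; rewrite !scale1r. Qed.

Lemma rep0 a : pi a 0 = 0.
Proof. by apply: (@addrI _ (pi a 0)); rewrite -repD !addr0. Qed.

Lemma repZ a (z : R[i]) x : pi a (z *: x) = z *: pi a x.
Proof. by have := representation_linear a rp z x 0; rewrite rep0 !addr0. Qed.

Lemma rep_sum a n (F : 'I_n -> H) : pi a (\sum_i F i) = \sum_i pi a (F i).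
Proof. by apply: (big_morph (pi a)); [exact: repD | exact: rep0]. Qed.

Lemma sum_rep n (F : 'I_n -> A) x : pi (\sum_i F i) x = \sum_i pi (F i) x.
Proof.
apply: (big_morph (fun a => pi a x)); first by move=> a b;
  exact: srepD srp _ _ _.
by apply: (@addrI _ (pi 0 x)); rewrite -(srepD srp) !addr0.
Qed.

Lemma rep_contractive a x : rnorm (pi a x) <= rnorm a * rnorm x.
Proof.
rewrite -!form_norm_re_dotp.
exact: (star_rep_contractive (cstarAlg_star_algebra A) (@re_dotp_form R H) srp
  (cstarAlg_cstar_norm A) (@rnorm_complete R A)).
Qed.

Section Size.
Variable n : nat.

Definition amp_rep (x : mx_alg A n) (v : {ffun 'I_n -> H}) : {ffun 'I_n -> H} :=
  [ffun i => \sum_j pi (x i j) (v j)].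

Local Notation hform := (amp_form (@re_dotp R H) (n := n)).
Local Notation hnorm := (form_norm hform).

Let amp_realform : real_form hform := amp_real_form n (@re_dotp_form R H).

Lemma amp_star_rep :
  star_rep (@mx_cmul R A n : mx_alg A n -> mx_alg A n -> mx_alg A n)
    (@mx_cstar R A n) hform amp_rep.
Proof.
split.
- move=> a b v; apply/ffunP => i; rewrite !ffunE -big_split /=.
  by apply: eq_bigr => j _; rewrite mxE (srepD srp).
- move=> z a v; apply/ffunP => i; rewrite !ffunE scaler_sumr.
  by apply: eq_bigr => j _; rewrite mxE (srepZ srp).
- move=> a b v; apply/ffunP => i; rewrite !ffunE.
  under eq_bigr do rewrite mxE sum_rep.
  rewrite exchange_big /=; apply: eq_bigr => k _; rewrite ffunE rep_sum.
  by apply: eq_bigr => j _; rewrite (repM rp).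
- move=> a x y; rewrite /amp_form.
  under eq_bigr => i _ do rewrite ffunE /re_dotp.
  have suml (F : 'I_n -> H) w : Re (dotp (\sum_i F i) w) =
    \sum_i Re (dotp (F i) w).
    apply: (big_morph (fun a => Re (dotp a w))) => [u v|];
      last by rewrite dotp0l.
    by rewrite dotpDl raddfD.
  have sumr (F : 'I_n -> H) w : Re (dotp w (\sum_i F i)) =
    \sum_i Re (dotp w (F i)).
    apply: (big_morph (fun a => Re (dotp w a))) => [u v|].
      by rewrite dotpDr raddfD.
    by rewrite dotpC dotp0l rmorph0.
  under eq_bigr do rewrite suml.
  rewrite exchange_big /=; apply: eq_bigr => j _.
  rewrite /re_dotp ffunE sumr; apply: eq_bigr => i _.
  by rewrite (rep_cstar rp) mxE.
Qed.

Lemma amp_rep_bound (x : mx_alg A n) v :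
  hnorm (amp_rep x v) <= (\sum_i \sum_j rnorm (x i j)) * hnorm v.
Proof.
apply: le_trans (amp_form_le (@re_dotp_form R H) _) _.
rewrite mulr_suml; apply: ler_sum => i _.
rewrite ffunE form_norm_re_dotp.
apply: (@le_trans _ _ (\sum_j rnorm (pi (x i j) (v j)))).
  elim/big_ind2: _ => [|a s b t ha hb|//]; first by rewrite rnorm0.
  by apply: le_trans (rnormD _ _) _; exact: lerD.
rewrite mulr_suml; apply: ler_sum => j _.
apply: le_trans (rep_contractive _ _) _; rewrite ler_wpM2l ?rnorm_ge0 //.
rewrite -form_norm_re_dotp; exact: (amp_form_ge (@re_dotp_form R H)).
Qed.

Lemma amp_rep_bounded (x : mx_alg A n) : exists2 c : R, 0 <= c &
  forall v, hnorm (amp_rep x v) <= c * hnorm v.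
Proof.
exists (\sum_i \sum_j rnorm (x i j)); last exact: amp_rep_bound.
by apply: sumr_ge0 => i _; apply: sumr_ge0 => j _; exact: rnorm_ge0.
Qed.

(** Tested on the vector with [w] at place [j] and 0 elsewhere. It yields both the injectivity of
    the amplification and the control of entries needed for completeness. *)
Lemma amp_rep_entry (x : mx_alg A n) (c : R) : 0 <= c ->
  (forall v, hnorm (amp_rep x v) <= c * hnorm v) ->
  forall i j w, rnorm (pi (x i j) w) <= c * rnorm w.
Proof.
move=> c0 xc i j w; pose v : {ffun 'I_n -> H} :=
  [ffun k => if k == j then w else 0].
have vi : hnorm v = rnorm w.
  rewrite /form_norm /amp_form (bigD1 j) //= big1 => [|k kj].
    by rewrite ffunE eqxx addr0 -form_norm_re_dotp.
  by rewrite ffunE (negbTE kj) /re_dotp dotp0l.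
rewrite -vi; apply: le_trans (xc v).
have -> : pi (x i j) w = amp_rep x v i.
  rewrite ffunE (bigD1 j) //= big1 => [|k kj];
    first by rewrite ffunE eqxx addr0.
  by rewrite ffunE (negbTE kj) rep0.
rewrite -form_norm_re_dotp; exact: (amp_form_ge (@re_dotp_form R H)).
Qed.

(** Supplies the comparison that [cstar_norm_unique] requires: whichever norm [N] was chosen, the
    operator norm lies below it. *)
Lemma is_cstar_mxnorm_rep (N : 'M[A]_n -> R[i]) : is_cstar_mxnorm N ->
  forall x v, hnorm (amp_rep x v) <= Re (N x) * hnorm v.
Proof.
move=> hN; exact: (star_rep_contractive (mx_star_algebra A n) amp_realform
  amp_star_rep (is_cstar_mxnorm_cstar_norm hN) (is_cstar_mxnorm_complete hN)).
Qed.

End Size.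

Hypothesis inj_pi : injective pi.

Lemma faithful_eq0 a : (forall x, pi a x = 0) -> a = 0.
Proof.
move=> a0; apply: inj_pi; apply/funext => x; rewrite a0.
by apply: (@addrI _ (pi 0 x)); rewrite -(srepD srp) !addr0.
Qed.

(** The operator norm of [pi] is a C*-norm below the complete norm of [A], so the two are equal by
    uniqueness. *)
Lemma faithful_isometric a (c : R) : 0 <= c ->
  (forall x, rnorm (pi a x) <= c * rnorm x) -> rnorm a <= c.
Proof.
move=> c0 ac.
have bnd b : exists2 d : R, 0 <= d & forall x,
    form_norm (@re_dotp R H) (pi b x) <= d * form_norm (@re_dotp R H) x.
  exists (rnorm b) => [|x]; first exact: rnorm_ge0.
  by rewrite !form_norm_re_dotp rep_contractive.
have hM : is_cstar_norm (@cmul R A) (@cstar R A) (op_norm (@re_dotp R H) pi).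
  apply: (op_norm_cstar_norm (cstarAlg_star_algebra A) (@re_dotp_form R H) srp
    bnd).
  move=> b b0; apply: faithful_eq0 => x; apply: rnorm0_eq0.
  by rewrite -form_norm_re_dotp.
rewrite (cstar_norm_unique (cstarAlg_star_algebra A) (cstarAlg_cstar_norm A)
  (@rnorm_complete R A) hM) => [|b].
  by apply: op_norm_le => // x; rewrite !form_norm_re_dotp.
apply: op_norm_le => [|x]; first exact: rnorm_ge0.
by rewrite !form_norm_re_dotp rep_contractive.
Qed.

Section FaithfulSize.
Variable n : nat.

Local Notation hform := (amp_form (@re_dotp R H) (n := n)).
Local Notation opn := (op_norm hform (@amp_rep n)).

Let amp_realform : real_form hform := amp_real_form n (@re_dotp_form R H).

Lemma amp_op_norm_cstar :
  is_cstar_norm (@mx_cmul R A n : mx_alg A n -> mx_alg A n -> mx_alg A n)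
    (@mx_cstar R A n) opn.
Proof.
apply: (op_norm_cstar_norm (mx_star_algebra A n) amp_realform (@amp_star_rep n)
  (@amp_rep_bounded n)).
move=> x x0; apply/matrixP => i j; rewrite mxE; apply: faithful_eq0 => w.
apply: rnorm0_eq0; apply/eqP; rewrite eq_le rnorm_ge0 andbT.
rewrite -(mul0r (rnorm w)); apply: amp_rep_entry => // v.
by rewrite x0 mul0r.
Qed.

(** The operator norm lies between the norm of each entry, because [pi] is isometric, and the sum of
    the norms of all entries. Completeness of [A] therefore applies entry by entry. *)
Lemma amp_op_norm_complete : norm_complete opn.
Proof.
have bnd := @amp_rep_bounded n.
have entry (x : mx_alg A n) i j : rnorm (x i j) <= opn x.
  apply: faithful_isometric; first exact: op_norm_ge0 bnd _.
  apply: amp_rep_entry; first exact: op_norm_ge0 bnd _.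
  exact: op_norm_bound bnd _.
have le_sum (x : mx_alg A n) : opn x <= \sum_i \sum_j rnorm (x i j).
  apply: op_norm_le; last exact: amp_rep_bound.
  by apply: sumr_ge0 => i _; apply: sumr_ge0 => j _; exact: rnorm_ge0.
move=> u cu.
have /choice[l ul] (ij : 'I_n * 'I_n) : exists l : A, forall e : R, 0 < e ->
    exists m, forall k, (m <= k)%N -> rnorm (u k ij.1 ij.2 - l) < e.
  apply: rnorm_complete => e e0; have [m Hm] := cu e e0.
  exists m => k k' mk mk'; apply: le_lt_trans (Hm _ _ mk mk').
  by have := entry (u k - u k') ij.1 ij.2; rewrite !mxE.
exists (\matrix_(i, j) l (i, j)) => e e0.
(* There are [n * n] entries; the added 1 makes the sum strictly smaller than [e] and covers
   [n = 0]. *)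
pose d := e / (1 + (n * n)%:R).
have d0 : 0 < d by rewrite divr_gt0 // ltr_pwDl.
have /choice[m Hm] (ij : 'I_n * 'I_n) := ul ij d d0.
exists (\max_ij m ij)%N => k mk; apply: le_lt_trans (le_sum _) _.
apply: (@le_lt_trans _ _ (\sum_(i < n) \sum_(j < n) d)).
  apply: ler_sum => i _; apply: ler_sum => j _; rewrite !mxE;
    apply/ltW/(Hm (i, j)).
  by apply: leq_trans mk; exact: (leq_bigmax (i, j)).
rewrite !sumr_const card_ord -mulrnA -mulr_natr /d.
by rewrite mulrAC ltr_pdivrMr ?ltr_pM2l ?ltrDr // ltr_pwDl.
Qed.

(** The arbitrary choice made by [xget] is resolved here: the operator norm of the amplification is
    admissible, and any admissible norm dominates it and so equals it. *)
Lemma cstar_mxnormE (x : 'M[A]_n) : cstar_mxnorm x = (opn x)%:C.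
Proof.
have hM := amp_op_norm_cstar.
suff -> : @cstar_mxnorm R A n = (fun y : 'M[A]_n => (opn y)%:C) by [].
apply: xget_unique.
  exact: cstar_norm_is_cstar_mxnorm amp_op_norm_complete.
move=> N hN; apply/funext => y.
rewrite [LHS](ge0_ReE (mxnorm_ge0 hN y)); congr _%:C.
apply: (cstar_norm_unique (mx_star_algebra A n) (is_cstar_mxnorm_cstar_norm hN)
  (is_cstar_mxnorm_complete hN) hM) => z.
apply: op_norm_le; last exact: is_cstar_mxnorm_rep.
by rewrite -lecR -ge0_ReE (mxnorm_ge0 hN).
Qed.

Lemma is_cstar_mxnorm_cstar_mxnorm : is_cstar_mxnorm (@cstar_mxnorm R A n).
Proof.
have -> : @cstar_mxnorm R A n = (fun y : 'M[A]_n => (opn y)%:C).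
  by apply/funext => y; exact: cstar_mxnormE.
exact: cstar_norm_is_cstar_mxnorm amp_op_norm_cstar amp_op_norm_complete.
Qed.

End FaithfulSize.
End Amplification.

(** * Integration of compactly supported functions *)

Section CompactSupport.
Variables (R : realType) (G : topologicalType).
Hypothesis hausdorffG : hausdorff_space G.

Lemma rnorm_continuousP (V : normedModType R[i]) (f : G -> V) :
  continuous f <-> forall t (e : R), 0 < e ->
    \forall s \near t, rnorm (f s - f t) < e.
Proof.
split=> [cf t e e0|cf t].
  have e0' : (0 : R[i]) < e%:C by rewrite ltcR.
  have /cvgr_dist_lt/(_ _ e0') := cf t.
  by apply: filterS => s; rewrite rnorm_lt rnormBC.
apply/cvgrPdist_lt => e /gt0_ReE[-> e0].
by have := cf t _ e0; apply: filterS => s; rewrite rnorm_lt rnormBC.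
Qed.

Lemma real_continuousP (f : G -> R) :
  continuous f <-> forall t (e : R), 0 < e ->
    \forall s \near t, `|f s - f t| < e.
Proof.
split=> [cf t e e0|cf t].
  have /cvgr_dist_lt/(_ _ e0) := cf t.
  by apply: filterS => s; rewrite distrC.
apply/cvgrPdist_lt => e e0.
by have := cf t _ e0; apply: filterS => s; rewrite distrC.
Qed.

(** A compact set outside of which [f] vanishes is easier to transport than the closure of the
    support. In a Hausdorff space it is closed, hence contains that closure. *)
Lemma CcP (V : normedModType R[i]) (f : G -> V) : Cc f <->
  continuous f /\ exists2 K, compact K & forall t, ~ K t -> f t = 0.
Proof.
split=> [[cf cpt]|[cf [K cK f0]]].
  split => //; exists (closure [set t | f t != 0]) => // t nt.
  apply/eqP/negP => /negP ft; apply: nt; exact: subset_closure.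
split => //; apply: (subclosed_compact _ cK); first exact: closed_closure.
have clK : closed K by exact: compact_closed.
rewrite [X in _ `<=` X](closure_id _).1 //; apply: closureS => t /= ft.
by apply: contrapT => /f0 /eqP; rewrite (negbTE ft).
Qed.

Definition CcR (g : G -> R) : Prop :=
  continuous g /\ exists2 K, compact K & forall t, ~ K t -> g t = 0.

(** Scalar integrands are obtained from vector-valued functions by norms and functionals, all of
    which are Lipschitz and vanish at 0. *)
Lemma CcR_lipschitz_comp (V : normedModType R[i]) (f : G -> V) (l : V -> R)
  (c : R) :
  Cc f -> l 0 = 0 -> (forall x y, `|l x - l y| <= c * rnorm (x - y)) ->
  CcR (l \o f).
Proof.
move=> /CcP[cf [K cK f0]] l0 lc; split; last first.
  by exists K => // t /f0 /= ->.
apply/real_continuousP => t e e0.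
have c1 : 0 < `|c| + 1 by rewrite ltr_wpDl.
have /rnorm_continuousP/(_ t (e / (`|c| + 1))) := cf.
rewrite divr_gt0 // => /(_ isT); apply: filterS => s.
rewrite ltr_pdivlMr // => lt; apply: le_lt_trans lt.
apply: le_trans (lc _ _) _; rewrite mulrC ler_wpM2l ?rnorm_ge0 //.
by apply: le_trans (ler_norm _) _; rewrite lerDl.
Qed.

End CompactSupport.

Section Integration.
Variables (R : realType) (G : topologicalGroupType).
Hypothesis hausdorffG : hausdorff_space G.
Variable mu : {measure set (borel G) -> \bar R}.
Hypothesis haar_mu : left_haar_measure mu.

Lemma open_borel (U : set G) : open U -> measurable (U : set (borel G)).
Proof. exact: sub_sigma_algebra. Qed.

Lemma closed_borel (F : set G) : closed F -> measurable (F : set (borel G)).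
Proof.
move=> cF; rewrite -[F]setCK; apply: measurableC; apply: open_borel.
exact: closed_openC.
Qed.

Lemma compact_borel (K : set G) : compact K -> measurable (K : set (borel G)).
Proof. by move=> cK; apply: closed_borel; exact: compact_closed. Qed.

Lemma continuous_borel_measurable (g : G -> R) : continuous g ->
  measurable_fun setT (g : borel G -> R).
Proof.
move=> /continuousP cg; apply:
  (measurability _ (measurable_realfun.RGenOpens.measurableE R)).
move=> _ [_ [a [b ->] <-]]; rewrite setTI; apply: open_borel.
by apply: cg; exact: interval_open.
Qed.

Lemma CcR_integrable (g : G -> R) (D : set (borel G)) : CcR g -> measurable D ->
  mu.-integrable D (EFin \o (g : borel G -> R)).
Proof.
move=> [cg [K cK g0]] mD; have mK := compact_borel cK.
suff : mu.-integrable setT (EFin \o (g : borel G -> R)).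
  by apply: integrableS.
have gK : (g : borel G -> R) = g \_ K.
  apply/funext => t; rewrite patchE; case: ifPn => // /negP nK.
  by apply: g0 => Kt; apply: nK; rewrite inE.
rewrite gK.
have -> : EFin \o (g \_ K) = (EFin \o (g : borel G -> R)) \_ K.
  by apply/funext => t; rewrite /= !patchE; case: ifP.
apply/(integrable_mkcond (EFin \o (g : borel G -> R)) mK).
apply: (measurable_bounded_integrable mK).
- exact: haar_compact haar_mu _ cK.
- apply: measurable_funTS; exact: continuous_borel_measurable.
- have [|M [Mr MP]] := @compact_bounded R R^o (g @` K).
    by apply: continuous_compact => //; exact: continuous_subspaceT.
  by exists M; split => // x Mx t Kt; apply: MP Mx _ _; exists t.
Qed.

End Integration.

(** * Weak integrals of vector-valued functions *)

Section VectorIntegral.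
Variables (R : realType) (G : topologicalGroupType).
Hypothesis hausdorffG : hausdorff_space G.
Variable mu : {measure set (borel G) -> \bar R}.
Hypothesis haar_mu : left_haar_measure mu.
Variables (E : completeNormedModType R[i]) (I : Type) (l : I -> E -> R).

Record real_functional (phi : E -> R) : Prop := RealFunctional {
  rfunD : forall x y, phi (x + y) = phi x + phi y;
  rfunZ : forall (t : R) x, phi (t%:C *: x) = t * phi x;
  rfun_le : forall x, `|phi x| <= rnorm x
}.

Hypothesis hl : forall i, real_functional (l i).

Let lB i x y : l i (x - y) = l i x - l i y.
Proof.
by rewrite (rfunD (hl i)) -scaleN1r -(rmorphN1 (real_complex R)) (rfunZ (hl i))
  mulN1r.
Qed.

Let l0 i : l i 0 = 0.
Proof. by rewrite -(subrr (0 : E)) lB subrr. Qed.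

Lemma Cc_functional (F : G -> E) i : Cc F -> CcR (l i \o F).
Proof.
move=> cF; apply: (CcR_lipschitz_comp hausdorffG (c := 1) cF (l0 i)) => x y.
by rewrite -lB mul1r (rfun_le (hl i)).
Qed.

Lemma open_near_value (F : G -> E) (t : G) (e : R) : continuous F ->
  open [set s | rnorm (F s - F t) < e].
Proof.
move=> /rnorm_continuousP cF; rewrite openE => s /= st.
have := cF s (e - rnorm (F s - F t)); rewrite subr_gt0 => /(_ st).
apply: filterS => r; rewrite /= ltrBrDr; apply: le_lt_trans.
by rewrite -(subrKA (F s)) rnormD.
Qed.

(** The vector [v] is a Riemann sum over the sample points [s], and one [v] serves all functionals
    at once. Each step of the induction splits off from [D] the points whose value is within [e] of
    that at the first sample point. *)
Lemma integral_approx (F : G -> E) (e : R) (s : seq G) : Cc F -> 0 < e ->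
  forall D : set (borel G), measurable D -> (mu D < +oo)%E ->
  (forall t, D t -> exists2 r, r \in s & rnorm (F t - F r) < e) ->
  exists v, forall i,
    `|l i v - \int[mu]_(t in D) l i (F t)| <= e * fine (mu D).
Proof.
move=> cF e0; have [cF' _] := iffLR (CcP hausdorffG F) cF.
elim: s => [|r s IH] D mD Dfin Ds.
  have -> : D = set0 by rewrite -subset0 => t /Ds[].
  by exists 0 => i; rewrite l0 Rintegral_set0 subrr normr0 measure0 mulr0.
pose U : set (borel G) := [set t | rnorm (F t - F r) < e].
have mU : measurable U by apply: open_borel; exact: open_near_value.
have mDU : measurable (D `&` U) by exact: measurableI.
have mDnU : measurable (D `\` U) by exact: measurableD.
have fin1 : (mu (D `&` U) < +oo)%E.
  by apply: le_lt_trans Dfin; apply: le_measure; rewrite ?inE.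
have fin2 : (mu (D `\` U) < +oo)%E.
  by apply: le_lt_trans Dfin; apply: le_measure; rewrite ?inE //;
    exact: subDsetl.
have [|v Hv] := IH _ mDnU fin2.
  move=> t [Dt nUt]; have [q qs Hq] := Ds t Dt.
  move: qs; rewrite inE => /predU1P[qr|qs]; last by exists q.
  by exfalso; apply: nUt; rewrite /U /= -qr.
exists ((fine (mu (D `&` U)))%:C *: F r + v) => i.
have int A : measurable A ->
  mu.-integrable A (EFin \o ((l i \o F) : borel G -> R)).
  by move=> mA; apply: CcR_integrable => //; exact: Cc_functional.
have intc (c : R) : mu.-integrable (D `&` U) (EFin \o (cst c : borel G -> R)).
  apply: (measurable_bounded_integrable mDU fin1); first exact: measurable_cst.
  by exists `|c|; split; [exact: num_real | move=> x cx t _; exact: ltW].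
have DE : (D `&` U) `|` (D `\` U) = D by rewrite setUIDK.
have -> : fine (mu D) = fine (mu (D `&` U)) + fine (mu (D `\` U)).
  rewrite -[in LHS]DE measureU //; last first.
    by rewrite -subset0 => t [[_ Ut] [_ /(_ Ut)]].
  by rewrite fineD // ge0_fin_numE.
have -> : \int[mu]_(t in D) l i (F t) =
    \int[mu]_(t in D `&` U) l i (F t) + \int[mu]_(t in D `\` U) l i (F t).
  rewrite -[in LHS]DE Rintegral_setU //.
    by rewrite DE; exact: int.
  by apply/disj_setPS => t [[_ Ut] [_ nUt]].
rewrite (rfunD (hl i)) (rfunZ (hl i)) opprD addrACA.
apply: le_trans (ler_normD _ _) _; rewrite mulrDr; apply: lerD; last exact: Hv.
have near t : (D `&` U) t -> `|l i (F t) - l i (F r)| <= e.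
  by move=> [_ Ut]; rewrite -lB; apply: le_trans (rfun_le (hl i) _) _;
    exact: ltW.
have up : \int[mu]_(t in D `&` U) l i (F t) <=
  (l i (F r) + e) * fine (mu (D `&` U)).
  rewrite -(Rintegral_cst mu mDU); apply: le_Rintegral => //; first exact: int.
    exact: intc.
  by move=> t /near; rewrite ler_norml => /andP[_]; rewrite lerBlDl.
have low : (l i (F r) - e) * fine (mu (D `&` U)) <=
  \int[mu]_(t in D `&` U) l i (F t).
  rewrite -(Rintegral_cst mu mDU); apply: le_Rintegral => //; first exact: intc.
    exact: int.
  by move=> t /near; rewrite ler_norml => /andP[+ _]; rewrite lerBrDl.
rewrite ler_norml; apply/andP; split; lra.
Qed.

Hypothesis norming : forall v (c : R), 0 <= c -> (forall i, l i v <= c) ->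
  rnorm v <= c.

(* The approximations of [integral_approx] form a Cauchy sequence because the
   functionals [l] detect the norm. *)
Lemma vector_integral (F : G -> E) : Cc F ->
  exists v, forall i, l i v = \int[mu]_t l i (F t).
Proof.
move=> cF; have [cF' [K cK F0]] := iffLR (CcP hausdorffG F) cF.
have Kfin := haar_compact haar_mu cK.
have mK := compact_borel hausdorffG cK.
pose m := fine (mu K).
have m1 : 0 < m + 1 by rewrite ltr_wpDl // fine_ge0.
have intK i : \int[mu]_(t in K) l i (F t) = \int[mu]_t l i (F t).
  rewrite Rintegral_mkcond; congr (Rintegral _ _ _).
  apply/funext => t; rewrite patchE; case: ifPn => // /negP nK.
  by rewrite F0 ?l0 // => Kt; apply: nK; rewrite inE.
have /choice[u Hu] (n : nat) : exists v, forall i,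
    `|l i v - \int[mu]_t l i (F t)| <= 2^-1 ^+ n.
  (* [m] is the measure of the support, possibly 0; the tolerance makes the total error at most
     [2^-n]. Compactness provides finitely many sample points for it. *)
  have e0 : 0 < (2^-1 : R) ^+ n / (m + 1).
    by rewrite divr_gt0 // exprn_gt0 // invr_gt0.
  pose f (t : G) := [set s | rnorm (F s - F t) < 2^-1 ^+ n / (m + 1)].
  have := cK; rewrite compact_cover => /(_ G K f) [].
  - by move=> t _; exact: open_near_value.
  - by move=> t Kt; exists t => //; rewrite /f /= subrr rnorm0.
  move=> s _ Ks; have [t|v Hv] :=
    integral_approx cF e0 mK Kfin (s := finmap.enum_fset s).
    by move=> /Ks[r rs Fr]; exists r.
  exists v => i; rewrite -intK; apply: le_trans (Hv i) _.
  rewrite mulrAC ler_pdivrMr // ler_wpM2l ?exprn_ge0 ?invr_ge0 //.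
  by rewrite lerDl.
have q01 : 0 <= (2^-1 : R) < 1 by rewrite invr_ge0 ler0n invf_lt1 ?ltr1n.
have bnd n k : (n <= k)%N -> rnorm (u n - u k) <= 2 * 2^-1 ^+ n.
  move=> nk; apply: norming => [|i].
    by rewrite mulr_ge0 // exprn_ge0 // invr_ge0.
  rewrite lB; have := Hu n i; have := Hu k i; rewrite !ler_norml.
  have : (2^-1 : R) ^+ k <= 2^-1 ^+ n.
    by apply: ler_wiXn2l => //; have /andP[? /ltW] := q01.
  move=> ? /andP[? ?] /andP[? ?]; lra.
have [|v Hv] := @rnorm_complete R E u.
  move=> e e0; have [n Hn] := geometric_small 4 q01 e0.
  exists n => i j ni nj; rewrite -(subrKA (u n)).
  apply: le_lt_trans (rnormD _ _) _; rewrite (rnormBC (u i)).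
  have := bnd _ _ ni; have := bnd _ _ nj; lra.
exists v => i; apply/eqP; rewrite -subr_eq0 -normr_eq0 eq_le normr_ge0 andbT.
apply/ler_addgt0Pr => e e0; rewrite add0r.
have e2 : 0 < e / 2 by rewrite divr_gt0.
have [n Hn] := geometric_small 1 q01 e2.
have [k Hk] := Hv _ e2.
pose j := maxn n k.
have /ltW := Hk j (leq_maxr _ _); rewrite rnormBC => Hj.
have := le_trans (rfun_le (hl i) _) Hj; rewrite lB.
have := Hu j i.
have : (2^-1 : R) ^+ j <= 2^-1 ^+ n.
  by apply: ler_wiXn2l; [have /andP[] := q01|have /andP[_ /ltW] :=
    q01|exact: leq_maxl].
rewrite !ler_norml => ? /andP[? ?] /andP[? ?]; apply/andP; split; lra.
Qed.

End VectorIntegral.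

(** * Translations and Haar measure *)

Section TopologicalGroup.
Variable G : topologicalGroupType.

Lemma translate_continuous (s : G) : continuous (fun t : G => (s * t)%g).
Proof.
move=> t.
apply: (@continuous2_cvg _ _ _ _ _ _ (cst s) id (fun x y : G => (x * y)%g)).
- exact: (@mulg_continuous G (s, t)).
- exact: cvg_cst.
- exact: cvg_id.
Qed.

Lemma translate_compact (s : G) (K : set G) : compact K ->
  compact [set (s * t)%g | t in K].
Proof.
move=> cK; apply: continuous_compact => //.
by apply: continuous_subspaceT => t; exact: translate_continuous.
Qed.

(** Carries estimates at the unit to continuity at an arbitrary point [s], since [t^-1 s] tends to
    the unit as [t] tends to [s]. *)
Lemma near_translate (s : G) (P : set G) : (\forall u \near (1%g : G), P u) ->
  \forall t \near s, P (t^-1 * s)%g.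
Proof.
move=> P1.
have cv : (fun t : G => (t^-1 * s)%g) @ s --> (s^-1 * s)%g.
  apply: (@continuous2_cvg _ _ _ _ _ _ (fun t : G => (t^-1)%g) (cst s)
    (fun x y : G => (x * y)%g)).
  - exact: (@mulg_continuous G ((s^-1)%g, s)).
  - exact: invg_continuous.
  - exact: cvg_cst.
have P1' : nbhs (s^-1 * s)%g P by rewrite mulVg.
exact: (cv _ P1').
Qed.

Lemma near_inv1 (P : set G) : (\forall u \near (1%g : G), P u) ->
  \forall u \near (1%g : G), P (u^-1)%g.
Proof.
move=> P1; have P1' : nbhs (1^-1)%g P by rewrite invg1.
exact: (@invg_continuous G (1%g : G) _ P1').
Qed.

End TopologicalGroup.

Section CcGroup.
Variables (R : realType) (G : topologicalGroupType).
Hypothesis hausdorffG : hausdorff_space G.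

Lemma Cc_translate (V : normedModType R[i]) (f : G -> V) (s : G) : Cc f ->
  Cc (fun t => f (s^-1 * t)%g).
Proof.
move=> /(CcP hausdorffG)[cf [K cK f0]]; apply/(CcP hausdorffG); split.
  by move=> t; apply: continuous_comp;
    [exact: translate_continuous | exact: cf].
exists [set (s * t)%g | t in K]; first exact: translate_compact.
move=> t nKt; apply: f0 => Kt; apply: nKt; exists (s^-1 * t)%g => //.
by rewrite mulVKg.
Qed.

(** Compactness gives uniformity for [t] in [K]. When only [u t] lies in [K], the estimate for
    [u^-1] at [u t] is used, which is why both [u] and [u^-1] are kept near the unit. *)
Lemma Cc_uniformly_continuous (V : normedModType R[i]) (f : G -> V) (e : R) :
  Cc f -> 0 < e ->
  \forall u \near (1%g : G), forall t, rnorm (f (u * t)%g - f t) < e.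
Proof.
move=> /(CcP hausdorffG)[cf [K cK f0]] e0.
pose P (u : G) := forall t, K t -> rnorm (f (u * t)%g - f t) < e.
have P1 : \forall u \near (1%g : G), P u.
  have /compact_near_coveringP := cK.
  move=> /(_ G (nbhs (1%g : G)) (fun u t => rnorm (f (u * t)%g - f t) < e) _).
  apply=> t Kt.
  have e2 : 0 < e / 2 by rewrite divr_gt0.
  have /rnorm_continuousP/(_ t _ e2) near_t := cf.
  have near_ut : \forall p \near ((1%g : G), t),
    rnorm (f (p.1 * p.2)%g - f t) < e / 2.
    have h : nbhs (1 * t)%g [set s | rnorm (f s - f t) < e / 2] by
      rewrite mul1g.
    exact: (@mulg_continuous G ((1%g : G), t) _ h).
  have [[U V'] [U1 Vt] UV] := near_ut.
  exists (V' `&` [set s | rnorm (f s - f t) < e / 2], U).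
    by split => //=; exact: filterI.
  move=> [s u] /= [[Vs fs] Uu].
  have /= := UV (u, s) (conj Uu Vs) => fus.
  rewrite /= in fs; rewrite -(subrKA (f t)).
  apply: le_lt_trans (rnormD _ _) _; rewrite (rnormBC (f t)); lra.
have PV : \forall u \near (1%g : G), P u /\ P (u^-1)%g.
  by apply: filterI; [exact: P1 | exact: near_inv1 P1].
move: PV; apply: filterS => u [Pu Pv] t.
have [Kt|nKt] := pselect (K t); first exact: Pu.
have [Kut|nKut] := pselect (K (u * t)%g); last by rewrite !f0 // subrr rnorm0.
by have := Pv _ Kut; rewrite mulKg rnormBC.
Qed.

End CcGroup.

Section Haar.
Variables (R : realType) (G : topologicalGroupType).
Hypothesis hausdorffG : hausdorff_space G.
Variable mu : {measure set (borel G) -> \bar R}.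
Hypothesis haar_mu : left_haar_measure mu.

Lemma translate_measurable (s : G) :
  measurable_fun setT ((fun t => (s * t)%g) : borel G -> borel G).
Proof.
have gen : @measurable _ (borel G) = <<s @open G >> by [].
apply: (measurability _ gen).
move=> _ [U oU <-]; rewrite setTI; apply: open_borel.
by move: oU; have /continuousP := @translate_continuous G s; apply.
Qed.

Lemma integral_translate (g : G -> R) (s : G) : CcR g ->
  \int[mu]_t g (s^-1 * t)%g = \int[mu]_t g t.
Proof.
move=> cg; pose phi : borel G -> borel G := fun t => (s^-1 * t)%g.
have mphi : measurable_fun setT phi by exact: translate_measurable.
have push A : measurable A -> pushforward mu phi A = mu A.
  move=> mA; rewrite /pushforward -[RHS](haar_left_invariant haar_mu s mA).
  congr (mu _); apply/seteqP; split => [t At|_ [t At <-]].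
    by exists (s^-1 * t)%g => //; rewrite mulVKg.
  by rewrite /preimage /= /phi mulKg.
rewrite /Rintegral; congr fine.
rewrite -[RHS](@eq_measure_integral _ _ _ _ _ (pushforward mu phi)); last first.
  by move=> A mA _; exact: push.
have mg : measurable_fun setT (EFin \o (g : borel G -> R)).
  by apply/measurable_EFinP; apply: continuous_borel_measurable; have [] := cg.
have cgs : CcR (fun t => g (s^-1 * t)%g).
  have [cg' [K cK g0]] := cg; split.
    by move=> t; apply: continuous_comp;
      [exact: translate_continuous | exact: cg'].
  exists [set (s * t)%g | t in K]; first exact: translate_compact.
  move=> t nKt; apply: g0 => Kt; apply: nKt; exists (s^-1 * t)%g => //.
  by rewrite mulVKg.
by rewrite (integral_pushforward mphi mg
  (CcR_integrable hausdorffG haar_mu cgs measurableT) measurableT).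
Qed.

(** If [U] were null, so would be its translates, and every compact set, being covered by finitely
    many of them. Inner regularity of the whole group would then make [mu] zero. *)
Lemma haar_open_gt0 (U : set G) (t : G) : open U -> U t -> (0 < mu U)%E.
Proof.
move=> oU Ut; rewrite lt_def measure_ge0 andbT; apply/eqP => U0.
apply: (haar_neq0 haar_mu).
rewrite (haar_inner haar_mu (U := setT)) //; last exact: openT.
have tr0 s : mu [set (s * r)%g | r in U] = 0%E.
  by rewrite (haar_left_invariant haar_mu) //; exact: open_borel.
have otr s : open [set (s * r)%g | r in U].
  rewrite (_ : [set _ | _ in _] = (fun r => (s^-1 * r)%g) @^-1` U).
    by move: oU; have /continuousP := @translate_continuous G (s^-1)%g; apply.
  apply/seteqP; split => [_ [r Ur <-]|r Ur];
    first by rewrite /preimage /= mulKg.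
  by exists (s^-1 * r)%g => //; rewrite mulVKg.
have K0 K : compact K -> mu K = 0%E.
  move=> cK; have := cK; rewrite compact_cover.
  move=> /(_ G setT (fun s => [set (s * r)%g | r in U])) [].
  - by move=> s _; exact: otr.
  - move=> s _; exists (s * t^-1)%g => //; exists t => //.
    by rewrite mulgVK.
  move=> D _ KD.
  have null (r : seq G) (X : set (borel G)) : measurable X ->
      (forall x, X x -> exists2 s, s \in r & [set (s * y)%g | y in U] x) ->
      mu X = 0%E.
    elim: r X => [|a r IH] X mX Xr.
      have -> : X = set0 by rewrite -subset0 => x /Xr[].
      exact: measure0.
    have mUa : measurable ([set (a * y)%g | y in U] : set (borel G)).
      by apply: open_borel; exact: otr.
    have -> : mu X = (mu (X `\` [set (a * y)%g | y in U]) +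
        mu (X `&` [set (a * y)%g | y in U]))%E by exact: measureDI.
    rewrite IH ?add0e; first last.
    - move=> x [Xx nx]; have [s sr sx] := Xr x Xx; exists s => //.
      by move: sr; rewrite inE => /predU1P[sa|//]; move: nx; rewrite -sa.
    - exact: measurableD.
    apply/eqP; rewrite eq_le measure_ge0 andbT -[leRHS](tr0 a).
    by apply: le_measure; rewrite ?inE //; exact: measurableI.
  apply: (null (finmap.enum_fset D)); first exact: compact_borel.
  by move=> x /KD[s sD sx]; exists s.
apply/eqP; rewrite eq_le; apply/andP; split.
  by apply: ge_ereal_sup => _ [K [cK _] <-]; rewrite K0.
by apply: ereal_sup_ubound; exists set0; rewrite ?measure0 //; split => //;
  exact: compact0.
Qed.

Lemma integral_gt0 (g : G -> R) (t : G) : CcR g -> (forall s, 0 <= g s) ->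
  0 < g t -> 0 < \int[mu]_s g s.
Proof.
move=> cg g0 gt; have [cg' [K cK gK]] := cg.
pose U : set (borel G) := [set s | g t / 2 < g s].
have oU : open U.
  have /continuousP cgo := cg'.
  have -> : U = g @^-1` `]g t / 2, +oo[%classic.
    by apply/seteqP; split => s; rewrite /U /= in_itv /= andbT.
  by apply: cgo; exact: interval_open.
have mU := open_borel oU.
have Ut : U t by rewrite /U /=; lra.
have UK : U `<=` K.
  move=> s; rewrite /U /= => Us; apply: contrapT => /gK gs0.
  by move: Us; rewrite gs0; lra.
have Ufin : (mu U < +oo)%E.
  apply: le_lt_trans (haar_compact haar_mu cK).
  by apply: le_measure; rewrite ?inE //; exact: compact_borel.
have U0 : 0 < fine (mu U) by rewrite fine_gt0 // (haar_open_gt0 oU Ut).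
apply: (@lt_le_trans _ _ (g t / 2 * fine (mu U))).
  by rewrite mulr_gt0 // divr_gt0.
rewrite -(Rintegral_cst mu mU).
apply: (@le_trans _ _ (\int[mu]_(s in U) g s)).
  apply: le_Rintegral => //.
  - apply: (measurable_bounded_integrable mU Ufin); first exact: measurable_cst.
    by exists `|g t / 2|; split;
      [exact: num_real | move=> x cx s _; exact: ltW].
  - exact: CcR_integrable.
  - by move=> s; rewrite /U /= => /ltW.
rewrite Rintegral_mkcond; apply: le_Rintegral => //.
- have -> : EFin \o (g : borel G -> R) \_ U = (EFin \o (g : borel G -> R)) \_ U.
    by apply/funext => s; rewrite /= !patchE; case: ifP.
  apply/(integrable_mkcond (EFin \o (g : borel G -> R)) mU).
  exact: CcR_integrable.
- exact: CcR_integrable.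
- by move=> s _; rewrite patchE; case: ifP.
Qed.

End Haar.

Section CcAlgebra.
Variables (R : realType) (G : topologicalType).
Hypothesis hausdorffG : hausdorff_space G.

Lemma CcR_comp (g : G -> R) (phi : R -> R) : CcR g -> continuous phi ->
  phi 0 = 0 -> CcR (phi \o g).
Proof.
move=> [cg [K cK g0]] cphi phi0; split.
  by move=> t; apply: continuous_comp; [exact: cg | exact: cphi].
by exists K => // t /g0 /= ->.
Qed.

Lemma CcR_scale (g : G -> R) (c : R) : CcR g -> CcR (fun t => c * g t).
Proof.
move=> cg; apply: (CcR_comp (phi := fun x => c * x) cg); last exact: mulr0.
by move=> x; apply: continuousM; [exact: cvg_cst | exact: cvg_id].
Qed.

Lemma CcR_sqr (g : G -> R) : CcR g -> CcR (fun t => g t ^+ 2).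
Proof.
move=> cg; apply: (CcR_comp (phi := fun x => x ^+ 2) cg);
  last by rewrite expr0n.
by move=> x; exact: exprn_continuous.
Qed.

Lemma CcR_Cc (g : G -> R) : CcR g -> Cc ((fun t => (g t)%:C) : G -> R[i]^o).
Proof.
move=> [cg [K cK g0]]; apply/(CcP hausdorffG); split; last first.
  by exists K => // t /g0 ->.
apply/rnorm_continuousP => t e e0.
have /real_continuousP/(_ t e e0) := cg; apply: filterS => s.
by rewrite -rmorphB rnormR.
Qed.

Lemma CcR_rnorm (V : normedModType R[i]) (f : G -> V) : Cc f ->
  CcR (fun t => rnorm (f t)).
Proof.
move=> cf; apply: (CcR_lipschitz_comp hausdorffG (c := 1) cf (l := @rnorm R V)).
  exact: rnorm0.
move=> x y; rewrite mul1r ler_norml; apply/andP; split.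
  by rewrite lerBrDr -lerBrDl opprK rnormBC addrC -lerBlDr;
    have := rnormD (y - x) x; rewrite subrK; lra.
by have := rnormD (x - y) y; rewrite subrK; lra.
Qed.

Lemma Cc_scale (V : normedModType R[i]) (f : G -> R[i]) (F : G -> V) :
  Cc (f : G -> R[i]^o) -> continuous F -> Cc (fun t => f t *: F t).
Proof.
move=> /(CcP hausdorffG)[cf [K cK f0]] cF; apply/(CcP hausdorffG); split.
  by move=> t; apply: (@cvgZ _ V _ _ _ f F); [exact: cf | exact: cF].
by exists K => // t /f0 ->; rewrite scale0r.
Qed.

Lemma Cc_sub (V : normedModType R[i]) (f g : G -> V) : Cc f -> Cc g ->
  Cc (fun t => f t - g t).
Proof.
move=> /(CcP hausdorffG)[cf [K cK f0]] /(CcP hausdorffG)[cg [K' cK' g0]].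
apply/(CcP hausdorffG); split.
  by move=> t; apply: cvgB; [exact: cf | exact: cg].
exists (K `|` K'); first exact: compactU.
move=> t nKK'; rewrite f0 ?g0 ?subrr //.
  by move=> Kt; apply: nKK'; right.
by move=> Kt; apply: nKK'; left.
Qed.

End CcAlgebra.

Section Bump.
Variables (R : realType) (G : topologicalGroupType).
Hypotheses (hausdorffG : hausdorff_space G) (lcG : locally_compact [set: G]).

(** Complete regularity separates the unit from the closed set [B] by a function equal to 0 at the
    unit and 1 on [B]. One minus this function vanishes outside [W] and outside the compact
    neighbourhood [U0]. *)
Lemma bump_function (W : set G) : nbhs (1%g : G) W ->
  exists g : G -> R, [/\ CcR g, forall t, 0 <= g t, 0 < g 1%g &
    forall t, ~ W t -> g t = 0].
Proof.
move=> W1.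
have [U0 U1 [cU0 _]] := @lcG (1%g : G) I.
have {}U1 : nbhs (1%g : G) U0 by move: U1; rewrite /within /=;
  apply: filterS => t; apply.
pose B := ~` (interior (W `&` U0)).
have clB : closed B by apply: open_closedC; exact: open_interior.
have nB1 : ~ B 1%g by apply; exact: filterI.
have /(@uniform_separatorP _ R)[f [cf f01 f0 f1]] :=
  @locally_compact_completely_regular _ R lcG hausdorffG _ _ clB nB1.
have f_ge0 t : 0 <= 1 - f t.
  have := f01 (f t) (ex_intro2 _ _ t I erefl).
  by rewrite /= in_itv /= => /andP[_]; lra.
have f_out t : ~ (W t /\ U0 t) -> 1 - f t = 0.
  move=> nWt; rewrite (f1 (f t)) ?subrr //; exists t => //.
  by move=> /interior_subset.
exists (fun t => 1 - f t); split => //.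
- split.
    by move=> t; apply: cvgB; [exact: cvg_cst | exact: cf].
  by exists U0 => // t nU; apply: f_out => -[].
- by rewrite (f0 (f 1%g)) ?subr0 //; exists 1%g.
- by move=> t nW; apply: f_out => -[].
Qed.

End Bump.

Section L2.
Variables (R : realType) (G : topologicalGroupType).
Hypothesis hausdorffG : hausdorff_space G.
Variable mu : {measure set (borel G) -> \bar R}.
Hypothesis haar_mu : left_haar_measure mu.

(** The integrand lives on the union of [K] and [u^-1 K], of measure at most [2 * m] by left
    invariance, and is uniformly small there. In [d], the term [+ 1] keeps the denominator
    positive. *)
Lemma integral_translate_near (V : normedModType R[i]) (xi : G -> V) (e : R) :
  Cc xi -> 0 < e ->
  \forall u \near (1%g : G), \int[mu]_t (rnorm (xi (u * t)%g - xi t) ^+ 2) <= e.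
Proof.
move=> cxi e0; have [_ [K cK xi0]] := iffLR (CcP hausdorffG xi) cxi.
pose m := fine (mu K).
have m0 : 0 <= m by exact: fine_ge0.
pose d := Num.sqrt (e / (2 * m + 1)).
have m1 : 0 < 2 * m + 1 by rewrite ltr_wpDl // mulr_ge0.
have d0 : 0 < d by rewrite sqrtr_gt0 divr_gt0.
have := Cc_uniformly_continuous hausdorffG cxi d0; apply: filterS => u Hu.
pose K' : set G := [set (u^-1 * t)%g | t in K].
have cK' : compact K' by exact: translate_compact.
have mK := compact_borel hausdorffG cK;
  have mK' := compact_borel hausdorffG cK'.
pose D : set (borel G) := K `|` K'.
have mD : measurable D by exact: measurableU.
have Kfin := haar_compact haar_mu cK.
have K'E : mu K' = mu K by exact: haar_left_invariant haar_mu _ _ mK.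
have Dle : (mu D <= mu K + mu K')%E by exact: measureU2.
have Dfin : (mu D < +oo)%E.
  by apply: le_lt_trans Dle _; rewrite K'E lte_add_pinfty.
have fineD_le : fine (mu D) <= 2 * m.
  have : (fine (mu D) <= fine (mu K + mu K'))%R.
    rewrite fine_le // ?ge0_fin_numE // ?K'E ?lte_add_pinfty //.
    by rewrite adde_ge0.
  by rewrite K'E fineD ?ge0_fin_numE // -/m; lra.
pose h t := rnorm (xi (u * t)%g - xi t) ^+ 2.
have ch : CcR h.
  apply: CcR_sqr; apply: CcR_rnorm => //; apply: Cc_sub => //.
  by have := Cc_translate hausdorffG (u^-1)%g cxi; rewrite invgK.
have -> : \int[mu]_t h t = \int[mu]_(t in D) h t.
  rewrite [RHS]Rintegral_mkcond; congr (Rintegral _ _ _).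
  apply/funext => t; rewrite patchE; case: ifPn => // /negP nD.
  rewrite /h !xi0 ?subrr ?rnorm0 ?expr0n // => Kt; apply: nD; rewrite inE.
    by left.
  by right; exists (u * t)%g => //; rewrite mulKg.
apply: (@le_trans _ _ (\int[mu]_(t in D) (cst (d ^+ 2) t))).
  apply: le_Rintegral => //.
  - exact: CcR_integrable.
  - apply: (measurable_bounded_integrable mD Dfin); first exact: measurable_cst.
    by exists `|d ^+ 2|; split; [exact: num_real | move=> x cx s _; exact: ltW].
  - move=> t _; rewrite /h ler_pXn2r ?nnegrE ?rnorm_ge0 ?ltW //.
rewrite Rintegral_cst //.
apply: (@le_trans _ _ (d ^+ 2 * (2 * m + 1))).
  by rewrite ler_wpM2l ?sqr_ge0 //; lra.
by rewrite sqr_sqrtr ?mulfVK ?gt_eqF //; apply/ltW/divr_gt0.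
Qed.

End L2.

(** * Inner products, and integrals in Hilbert spaces and C*-algebras *)

Section HilbertNorm.
Variables (R : realType) (H : hilbertType R).

Lemma re_dotpDl (x y w : H) : re_dotp (x + y) w = re_dotp x w + re_dotp y w.
Proof. exact: rformDl (@re_dotp_form R H) _ _ _. Qed.

Lemma re_dotpBl (x y w : H) : re_dotp (x - y) w = re_dotp x w - re_dotp y w.
Proof. by rewrite re_dotpDl (rformNl (@re_dotp_form R H)). Qed.

Lemma re_dotpZl (t : R) (x w : H) : re_dotp (t%:C *: x) w = t * re_dotp x w.
Proof. exact: rformZl (@re_dotp_form R H) _ _ _. Qed.

Lemma re_dotpZr (t : R) (x w : H) : re_dotp x (t%:C *: w) = t * re_dotp x w.
Proof. exact: rformZr (@re_dotp_form R H) _ _ _. Qed.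

Lemma re_dotpxx (x : H) : re_dotp x x = rnorm x ^+ 2.
Proof. by rewrite -form_norm_re_dotp (form_norm_sqr (@re_dotp_form R H)). Qed.

Lemma re_dotp_le (x y : H) : re_dotp x y <= rnorm x * rnorm y.
Proof.
by rewrite -!form_norm_re_dotp;
  exact: form_cauchy_schwarz (@re_dotp_form R H) _ _.
Qed.

Lemma normr_re_dotp_le (x y : H) : `|re_dotp x y| <= rnorm x * rnorm y.
Proof.
rewrite ler_norml re_dotp_le andbT lerNl -(rformNl (@re_dotp_form R H)).
by rewrite -(rnormN x) re_dotp_le.
Qed.

(** Real and imaginary parts are bounded separately, whence the factor 2. It is harmless in density
    arguments, where any bound will do. *)
Lemma rnorm_dotp_le (x y : H) : rnorm (dotp x y) <= 2 * (rnorm x * rnorm y).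
Proof.
have h1 := normr_re_dotp_le x y; have h2 := normr_re_dotp_le x ('i *: y).
rewrite re_dotp_i rnormZ rnorm_i mul1r in h2.
rewrite -(ler_pXn2r (n := 2)) ?nnegrE ?mulr_ge0 ?rnorm_ge0 //.
rewrite rnorm_sqr -[Re _ ^+ 2]real_normK ?num_real // -[Im _ ^+ 2]real_normK
  ?num_real //.
rewrite exprMn; have p0 : 0 <= rnorm x * rnorm y by rewrite mulr_ge0 ?rnorm_ge0.
have : `|Re (dotp x y)| ^+ 2 <= (rnorm x * rnorm y) ^+ 2.
  by rewrite ler_pXn2r ?nnegrE.
have : `|Im (dotp x y)| ^+ 2 <= (rnorm x * rnorm y) ^+ 2.
  by rewrite ler_pXn2r ?nnegrE.
have := sqr_ge0 (rnorm x * rnorm y); lra.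
Qed.

Lemma hilbert_norming (v : H) (c : R) : 0 <= c ->
  (forall w, rnorm w <= 1 -> re_dotp v w <= c) -> rnorm v <= c.
Proof.
move=> c0 vc; have [->//|v0] := eqVneq (rnorm v) 0.
have vpos : 0 < rnorm v by rewrite lt_def v0 rnorm_ge0.
have := vc (((rnorm v)^-1)%:C *: v).
rewrite rnormZ rnormR ger0_norm ?invr_ge0 ?rnorm_ge0 // mulVf // lexx =>
  /(_ isT).
by rewrite re_dotpZr re_dotpxx expr2 mulrA mulVf // mul1r.
Qed.

Lemma re_dotp_inj (v w : H) : (forall k, re_dotp v k = re_dotp w k) -> v = w.
Proof.
move=> vw; apply/eqP; rewrite -subr_eq0; apply/eqP/rnorm0_eq0/eqP.
rewrite eq_le rnorm_ge0 andbT; apply: hilbert_norming => // k _.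
by rewrite re_dotpBl vw subrr.
Qed.

End HilbertNorm.

Section HilbertIntegral.
Variables (R : realType) (G : topologicalGroupType).
Hypothesis hausdorffG : hausdorff_space G.
Variable mu : {measure set (borel G) -> \bar R}.
Hypothesis haar_mu : left_haar_measure mu.
Variable H : hilbertType R.

Lemma CcR_re_dotp (F : G -> H) (k : H) : Cc F -> CcR (fun t => re_dotp (F t) k).
Proof.
move=> cF; apply: (CcR_lipschitz_comp hausdorffG (c := rnorm k) cF
  (l := fun x => re_dotp x k)) => [|x y].
  by rewrite /re_dotp dotp0l.
by rewrite -re_dotpBl mulrC normr_re_dotp_le.
Qed.

(** [vector_integral] wants functionals of norm at most 1, hence vectors of the unit ball. Other
    vectors are reached by scaling, with [+ 1] to include the vector 0. *)
Let scaled_unit (k : H) : rnorm (((rnorm k + 1)^-1)%:C *: k) <= 1.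
Proof.
have k0 := rnorm_ge0 k.
rewrite rnormZ rnormR ger0_norm ?invr_ge0; last by lra.
by rewrite mulrC ler_pdivrMr; lra.
Qed.

Let unscale (k : H) : k = (rnorm k + 1)%:C *: (((rnorm k + 1)^-1)%:C *: k).
Proof.
have k0 := rnorm_ge0 k.
by rewrite scalerA -rmorphM /= mulfV ?scale1r // gt_eqF //; lra.
Qed.

Lemma hilbert_integral (F : G -> H) : Cc F ->
  exists v, forall k, re_dotp v k = \int[mu]_t re_dotp (F t) k.
Proof.
move=> cF.
have [||v vP] := @vector_integral R G hausdorffG mu haar_mu H
  {k : H | rnorm k <= 1}
    (fun i v => re_dotp v (sval i)) _ _ F cF.
- move=> [k k1] /=; split; [exact: (fun x y => re_dotpDl x y k)| |].
    by move=> t x; rewrite re_dotpZl.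
  move=> x; apply: le_trans (normr_re_dotp_le _ _) _.
  by rewrite ler_piMr ?rnorm_ge0.
- by move=> v c c0 vc; apply: hilbert_norming => // w w1;
  exact: vc (exist _ w w1).
exists v => k; rewrite {1}(unscale k) re_dotpZr
  (vP (exist (fun w : H => rnorm w <= 1) _ (scaled_unit k))) /=.
rewrite -RintegralZl //; last
  exact: (CcR_integrable hausdorffG haar_mu (CcR_re_dotp _ cF)).
congr (Rintegral _ _ _); apply/funext => t.
by rewrite -re_dotpZr -unscale.
Qed.

Variables (A : cstarAlgType R) (pi : A -> H -> H).
Hypothesis faithful_pi : faithful_representation pi.

Let rp : is_representation pi := proj1 faithful_pi.
Let srp := representation_star_rep rp.

(** Isometry of [pi] means that the functionals [Re <pi a x, y>] detect the norm of [A]. Weak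
    estimates in [H] thus become norm estimates in [A]. *)
Lemma faithful_norming a (c : R) : 0 <= c ->
  (forall x y, rnorm x <= 1 -> rnorm y <= 1 -> re_dotp (pi a x) y <= c) ->
  rnorm a <= c.
Proof.
move=> c0 ac; apply: (faithful_isometric rp (proj2 faithful_pi) c0) => x.
have unit w : rnorm w <= 1 -> rnorm (pi a w) <= c.
  by move=> w1; apply: hilbert_norming => // y y1; exact: ac.
have [x0|x0] := eqVneq (rnorm x) 0.
  by rewrite (rnorm0_eq0 x0) (rep0 rp) rnorm0 mulr0.
have xpos : 0 < rnorm x by rewrite lt_def x0 rnorm_ge0.
have := unit (((rnorm x)^-1)%:C *: x).
rewrite (repZ rp) !rnormZ rnormR ger0_norm ?invr_ge0 ?rnorm_ge0 // mulVf //.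
by rewrite lexx => /(_ isT); rewrite mulrC ler_pdivrMr.
Qed.

(** The integral is found in [A] itself and not merely among the operators on [H]; this keeps
    compressions inside [pi(A)]. *)
Lemma faithful_integral (F : G -> A) : Cc F ->
  exists a, forall x y, re_dotp (pi a x) y = \int[mu]_t re_dotp (pi (F t) x) y.
Proof.
move=> cF.
have le1 (x y : H) a : rnorm x <= 1 -> rnorm y <= 1 ->
    `|re_dotp (pi a x) y| <= rnorm a.
  move=> x1 y1; apply: le_trans (normr_re_dotp_le _ _) _.
  apply: (@le_trans _ _ (rnorm a * 1 * 1)); last by rewrite !mulr1.
  apply: ler_pM => //; rewrite ?rnorm_ge0 //.
  by apply: le_trans (rep_contractive rp _ _) _; rewrite ler_wpM2l ?rnorm_ge0.
have piB a b x : pi (a - b) x = pi a x - pi b x.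
  by rewrite (srepD srp) -scaleN1r (srepZ srp) scaleN1r.
pose I := {xy : H * H | rnorm xy.1 <= 1 /\ rnorm xy.2 <= 1}.
have [||a aP] := @vector_integral R G hausdorffG mu haar_mu A I
    (fun i a => re_dotp (pi a (sval i).1) (sval i).2) _ _ F cF.
- move=> [[x y] [x1 y1]] /=; split.
  + by move=> a b; rewrite (srepD srp) re_dotpDl.
  + by move=> t a; rewrite (srepZ srp) re_dotpZl.
  + by move=> a; exact: le1.
- move=> a c c0 ac; apply: faithful_norming => // x y x1 y1.
  exact: (ac (exist _ (x, y) (conj x1 y1))).
exists a => x y.
pose ux := ((rnorm x + 1)^-1)%:C *: x; pose uy := ((rnorm y + 1)^-1)%:C *: y.
have E b : re_dotp (pi b x) y =
    ((rnorm x + 1) * (rnorm y + 1)) * re_dotp (pi b ux) uy.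
  by rewrite {1}(unscale x) {1}(unscale y) (repZ rp) re_dotpZr re_dotpZl mulrCA
    mulrA.
have aE := aP (exist (fun xy => rnorm xy.1 <= 1 /\ rnorm xy.2 <= 1) (ux, uy)
  (conj (scaled_unit x) (scaled_unit y))).
rewrite /= in aE; rewrite E aE -RintegralZl //.
  by congr (Rintegral _ _ _); apply/funext => t; rewrite -E.
have cux : CcR (fun t => re_dotp (pi (F t) ux) uy).
  apply: (CcR_lipschitz_comp hausdorffG (c := 1) cF
    (l := fun b => re_dotp (pi b ux) uy)) => [|b b'].
    by rewrite -(subrr (0 : A)) piB subrr /re_dotp dotp0l.
  by rewrite -re_dotpBl -piB mul1r; apply: le1; exact: scaled_unit.
exact: (CcR_integrable hausdorffG haar_mu cux).
Qed.

End HilbertIntegral.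

(** * The regular representation *)

Section L2Space.
Variables (R : realType) (G : topologicalGroupType).
Hypothesis hausdorffG : hausdorff_space G.
Variable mu : {measure set (borel G) -> \bar R}.
Hypothesis haar_mu : left_haar_measure mu.
Variables (H L : hilbertType R) (iota : (G -> H) -> L).
Hypothesis hL : is_L2 mu iota.

Lemma L2B (xi eta : G -> H) : Cc xi -> Cc eta ->
  iota (fun t => xi t - eta t) = iota xi - iota eta.
Proof.
move=> cxi ceta.
have -> : (fun t => xi t - eta t) = (fun t => -1 *: eta t + xi t).
  by apply/funext => t; rewrite scaleN1r addrC.
by rewrite (L2_linear hL) // scaleN1r addrC.
Qed.

Lemma L2_re_dotp (xi eta : G -> H) : Cc xi -> Cc eta ->
  re_dotp (iota xi) (iota eta) = \int[mu]_t re_dotp (xi t) (eta t).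
Proof. by move=> cxi ceta; rewrite /re_dotp (L2_dotp hL). Qed.

Lemma L2_norm (xi : G -> H) : Cc xi ->
  rnorm (iota xi) ^+ 2 = \int[mu]_t (rnorm (xi t) ^+ 2).
Proof.
move=> cxi; rewrite -re_dotpxx L2_re_dotp //.
by congr (Rintegral _ _ _); apply/funext => t; rewrite re_dotpxx.
Qed.

Lemma L2_approx (k : L) (e : R) : 0 < e ->
  exists2 xi : G -> H, Cc xi & rnorm (k - iota xi) < e.
Proof.
move=> e0; have [|xi cxi kxi] := L2_dense hL k (e := e%:C);
  first by rewrite ltcR.
by exists xi => //; rewrite -rnorm_lt.
Qed.

(** The target [V] is general so that the lemma covers differences of operators as well as scalar
    differences of inner products. *)
Lemma L2_dense_eq0 (V : normedZmodType R[i]) (phi : L -> V) (M : R) :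
  (forall x y, phi (x - y) = phi x - phi y) ->
  (forall x, rnorm (phi x) <= M * rnorm x) ->
  (forall xi, Cc xi -> phi (iota xi) = 0) -> forall x, phi x = 0.
Proof.
move=> phiB phiM phi0 x; apply/rnorm0_eq0/eqP; rewrite eq_le rnorm_ge0 andbT.
apply/ler_addgt0Pr => e e0; rewrite add0r.
have M1 : 0 < `|M| + 1 by rewrite ltr_wpDl.
have [|xi cxi lt] := L2_approx x (e := e / (`|M| + 1)); first exact: divr_gt0.
rewrite -[phi x]subr0 -(phi0 _ cxi) -phiB.
apply: le_trans (phiM _) _.
rewrite ltr_pdivlMr // in lt; apply: le_trans (ltW lt).
rewrite mulrC ler_wpM2l ?rnorm_ge0 //.
by apply: le_trans (ler_norm _) _; rewrite lerDl.
Qed.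

Lemma bounded_operatorP (X : L -> L) : bounded_operator X ->
  [/\ forall x y, X (x + y) = X x + X y, forall x y, X (x - y) = X x - X y,
      forall (z : R[i]) x, X (z *: x) = z *: X x &
      exists2 M : R, 0 <= M & forall x, rnorm (X x) <= M * rnorm x].
Proof.
move=> [linX [M [M0 XM]]].
have XD x y : X (x + y) = X x + X y by have := linX 1 x y; rewrite !scale1r.
have X0 : X 0 = 0 by apply: (@addrI _ (X 0)); rewrite -XD !addr0.
have XZ (z : R[i]) x : X (z *: x) = z *: X x.
  by have := linX z x 0; rewrite X0 !addr0.
split => //; first by move=> x y; rewrite XD -scaleN1r XZ scaleN1r.
have ME := ge0_ReE M0.
exists (Re M) => [|x]; first by rewrite -lecR -ME.
by rewrite -lecR rmorphM /= -!rnormE -ME.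
Qed.

Lemma L2_ext (X Y : L -> L) : bounded_operator X -> bounded_operator Y ->
  (forall xi, Cc xi -> X (iota xi) = Y (iota xi)) -> forall x, X x = Y x.
Proof.
move=> /bounded_operatorP[_ XB _ [M M0 XM]]
  /bounded_operatorP[_ YB _ [M' M'0 YM]] XY x.
apply/eqP; rewrite -subr_eq0; apply/eqP.
apply: (L2_dense_eq0 (phi := fun x => X x - Y x) (M := M + M')).
- by move=> y z; rewrite XB YB !opprB addrACA [RHS]addrACA [- Y y + _]addrC.
- move=> y; apply: le_trans (rnormB _ _) _; rewrite mulrDl; exact: lerD.
- by move=> xi cxi; rewrite XY // subrr.
Qed.

Section LeftTranslation.
Variable lam : G -> L -> L.
Hypothesis hlam : is_left_translation iota lam.

Lemma lam_iota (s : G) (xi : G -> H) : Cc xi ->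
  lam s (iota xi) = iota (fun t => xi (s^-1 * t)%g).
Proof. by have [_] := hlam s; apply. Qed.

(** [is_left_translation] only provides some bound [M]. Left invariance makes [lam s] isometric on
    the dense subspace, and approximating [k] costs at most [(M + 1)] times the distance. *)
Lemma lam_le (s : G) (k : L) : rnorm (lam s k) <= rnorm k.
Proof.
have [blam _] := hlam s.
have [_ lamB _ [M M0 lamM]] := bounded_operatorP blam.
apply/ler_addgt0Pr => e e0.
have M1 : 0 < M + 1 by lra.
have [|xi cxi lt] := L2_approx k (e := e / (M + 1)); first exact: divr_gt0.
have iso : rnorm (lam s (iota xi)) = rnorm (iota xi).
  apply/eqP; rewrite -(eqrXn2 (n := 2)) ?rnorm_ge0 //; apply/eqP.
  rewrite lam_iota // !L2_norm //; last exact: Cc_translate.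
  rewrite -[RHS](integral_translate hausdorffG haar_mu s) //.
  by apply: CcR_sqr; exact: CcR_rnorm.
rewrite ltr_pdivlMr // in lt.
have := lamM (k - iota xi); rewrite lamB.
have := rnormD (lam s k - lam s (iota xi)) (lam s (iota xi)); rewrite subrK iso.
have := rnormD (iota xi - k) k; rewrite subrK (rnormBC (iota xi)).
lra.
Qed.

(** The substitution of [r t] for [t] leaves a single translation, by an element close to the unit
    when [s] is close to [r]. *)
Lemma lam_iotaB_norm (s r : G) (xi : G -> H) : Cc xi ->
  rnorm (lam s (iota xi) - lam r (iota xi)) ^+ 2 =
  \int[mu]_t (rnorm (xi (s^-1 * r * t)%g - xi t) ^+ 2).
Proof.
move=> cxi; rewrite !lam_iota // -L2B; try exact: Cc_translate.
rewrite L2_norm; last by apply: Cc_sub => //; exact: Cc_translate.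
rewrite -[RHS](integral_translate hausdorffG haar_mu r).
  by congr (Rintegral _ _ _); apply/funext => t; rewrite -mulgA mulVKg.
apply: CcR_sqr; apply: CcR_rnorm => //; apply: Cc_sub => //.
have := Cc_translate hausdorffG (s^-1 * r)^-1%g cxi.
by rewrite invgK.
Qed.

Lemma lam_continuous (k : L) : continuous (fun s => lam s k).
Proof.
apply/rnorm_continuousP => r e e0.
have e4 : 0 < e / 4 by rewrite divr_gt0.
have [xi cxi lt] := L2_approx k e4.
have e42 : 0 < (e / 4) ^+ 2 by rewrite exprn_gt0.
have := near_translate r (integral_translate_near hausdorffG haar_mu cxi e42).
apply: filterS => s.
rewrite -lam_iotaB_norm // ler_pXn2r ?nnegrE ?rnorm_ge0 ?(ltW e4) // => le.
have [_ lsB _ _] := bounded_operatorP (proj1 (hlam s)).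
have [_ lrB _ _] := bounded_operatorP (proj1 (hlam r)).
have h1 := lam_le s (k - iota xi); have h2 := lam_le r (k - iota xi).
rewrite lsB in h1; rewrite lrB in h2.
have h3 := rnormD (lam s k - lam s (iota xi)) (lam s (iota xi) - lam r k).
rewrite subrKA in h3.
have h4 := rnormD (lam s (iota xi) - lam r (iota xi))
  (lam r (iota xi) - lam r k).
rewrite subrKA (rnormBC (lam r (iota xi))) in h4.
lra.
Qed.

End LeftTranslation.

Section RegularRepresentation.
Variables (A : cstarAlgType R) (alpha : G -> A -> A).
Hypothesis actG : strongly_continuous_action alpha.
Variables (pi : A -> H -> H) (tpi : A -> L -> L).
Hypothesis rp : is_representation pi.
Hypothesis htpi : is_regular_representation alpha pi iota tpi.

Lemma action_inv_continuous a : continuous (fun t => alpha (t^-1)%g a).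
Proof.
move=> t.
have c1 := @invg_continuous G t;
  have c2 := @action_continuous _ _ _ _ actG a (t^-1)%g.
exact: (@continuous_comp _ _ _ (fun t : G => (t^-1)%g) (fun s => alpha s a) t c1
  c2).
Qed.

Lemma Cc_regular (a : A) (xi : G -> H) : Cc xi ->
  Cc (fun t => pi (alpha (t^-1)%g a) (xi t)).
Proof.
move=> cxi; have /(CcP hausdorffG)[cxi' [K cK xi0]] := cxi.
apply/(CcP hausdorffG); split; last by exists K => // t /xi0 ->;
  rewrite (rep0 rp).
apply/rnorm_continuousP => t e e0.
have srp := representation_star_rep rp.
have piB b c x : pi (b - c) x = pi b x - pi c x.
  by rewrite (srepD srp) -scaleN1r (srepZ srp) scaleN1r.
have piBr b x y : pi b (x - y) = pi b x - pi b y.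
  by rewrite (repD rp) -scaleN1r (repZ rp) scaleN1r.
pose M := rnorm (xi t) + rnorm (alpha (t^-1)%g a) + 1.
have M0 : 0 < M.
  by rewrite /M; have := rnorm_ge0 (xi t); have := rnorm_ge0 (alpha (t^-1)%g a);
    lra.
(* [d <= 1] bounds [|xi s|] by [|xi t| + 1]; the two error terms then add up to at most
   [d * M <= e / 2]. *)
pose d := Num.min 1 (e / (2 * M)).
have d0 : 0 < d by rewrite lt_min ltr01 divr_gt0 // mulr_gt0.
have n1 : \forall s \near t, rnorm (xi s - xi t) < d.
  by have /rnorm_continuousP/(_ t d d0) := cxi'.
have n2 : \forall s \near t, rnorm (alpha (s^-1)%g a - alpha (t^-1)%g a) < d.
  by have /rnorm_continuousP/(_ t d d0) := @action_inv_continuous a.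
near=> s.
have l1 : rnorm (xi s - xi t) < d by near: s.
have l2 : rnorm (alpha (s^-1)%g a - alpha (t^-1)%g a) < d by near: s.
have -> : pi (alpha (s^-1)%g a) (xi s) - pi (alpha (t^-1)%g a) (xi t) =
    pi (alpha (s^-1)%g a - alpha (t^-1)%g a) (xi s) +
    pi (alpha (t^-1)%g a) (xi s - xi t).
  by rewrite piB piBr subrKA.
apply: le_lt_trans (rnormD _ _) _.
have c1 := rep_contractive rp (alpha (s^-1)%g a - alpha (t^-1)%g a) (xi s).
have c2 := rep_contractive rp (alpha (t^-1)%g a) (xi s - xi t).
have xs : rnorm (xi s) <= rnorm (xi t) + 1.
  have := rnormD (xi s - xi t) (xi t); rewrite subrK.
  have : d <= 1 by rewrite ge_min lexx.
  lra.
have dM : d * M < e.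
  apply: (@le_lt_trans _ _ (e / (2 * M) * M)).
    by rewrite ler_pM2r // ge_min lexx orbT.
  have -> : e / (2 * M) * M = e / 2 by field; rewrite gt_eqF.
  lra.
have e1 : rnorm (alpha (s^-1)%g a - alpha (t^-1)%g a) * rnorm (xi s) <=
    d * (rnorm (xi t) + 1).
  by apply: ler_pM; rewrite ?rnorm_ge0 // ltW.
have e2 : rnorm (alpha (t^-1)%g a) * rnorm (xi s - xi t) <=
    rnorm (alpha (t^-1)%g a) * d.
  by rewrite ler_wpM2l ?rnorm_ge0 // ltW.
rewrite /M in dM; lra.
Unshelve. all: by end_near. Qed.

Lemma tpi_iota (a : A) (xi : G -> H) : Cc xi ->
  tpi a (iota xi) = iota (fun t => pi (alpha (t^-1)%g a) (xi t)).
Proof. by have [_] := htpi a; apply. Qed.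

(** [tpi] is specified only on functions in [Cc], where each law holds pointwise because [alpha]
    acts by star-automorphisms. Boundedness and density do the rest. *)
Lemma regular_is_representation : is_representation tpi.
Proof.
have srp := representation_star_rep rp.
have btpi a : bounded_operator (tpi a) by have [] := htpi a.
split.
- exact: btpi.
- move=> z a b; apply: L2_ext.
  + exact: btpi.
  + have [aD _ aZ [M M0 aM]] := bounded_operatorP (btpi a).
    have [bD _ bZ [M' M'0 bM]] := bounded_operatorP (btpi b).
    split.
      move=> w x y; rewrite aD bD aZ bZ !scalerDr addrACA !scalerA.
      by rewrite (mulrC w).
    exists (rnorm z * M + M')%:C; split.
      by rewrite ler0c addr_ge0 // mulr_ge0 ?rnorm_ge0.
    move=> x; rewrite !rnormE -rmorphM lecR mulrDl.
    apply: le_trans (rnormD _ _) _; apply: lerD => //.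
    by rewrite rnormZ -mulrA ler_wpM2l ?rnorm_ge0.
  + move=> xi cxi; rewrite !tpi_iota //.
    rewrite -(L2_linear hL); try exact: Cc_regular.
    congr iota; apply/funext => t.
    by rewrite (staraut_linear (action_aut actG _)) (rep_linear rp).
- move=> a b; apply: L2_ext.
  + exact: btpi.
  + have [aD _ aZ [M M0 aM]] := bounded_operatorP (btpi a).
    have [bD _ bZ [M' M'0 bM]] := bounded_operatorP (btpi b).
    split; first by move=> w x y; rewrite bD bZ aD aZ.
    exists (M * M')%:C; split; first by rewrite ler0c mulr_ge0.
    move=> x; rewrite !rnormE -rmorphM lecR -mulrA.
    by apply: le_trans (aM _) _; rewrite ler_wpM2l.
  + move=> xi cxi; rewrite !tpi_iota //; last exact: Cc_regular.
    congr iota; apply/funext => t.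
    by rewrite (starautM (action_aut actG _)) (repM rp).
- move=> a x y.
  have [_ aB _ [M M0 aM]] := bounded_operatorP (btpi a).
  have [_ sB _ [M' M'0 sM]] := bounded_operatorP (btpi (cstar a)).
  have dBl (u v w : L) : dotp (u - v) w = dotp u w - dotp v w.
    by rewrite dotpDl dotpNl.
  have dBr (u v w : L) : dotp w (u - v) = dotp w u - dotp w v.
    by rewrite dotpDr dotpNr.
  apply/eqP; rewrite -subr_eq0; apply/eqP.
  have reorder (u v w z : R[i]) : (u - v) - (w - z) = (u - w) - (v - z).
    by rewrite !opprB addrACA [RHS]addrACA [- v - w]addrC.
  (* Density is used in one argument at a time: here in [x], then in [y]. *)
  apply: (L2_dense_eq0 (phi :=
    fun x => dotp (tpi a x) y - dotp x (tpi (cstar a) y) : R[i])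
    (M := 2 * M * rnorm y + 2 * M' * rnorm y)).
  + by move=> u v; rewrite aB !dBl reorder.
  + move=> u; apply: le_trans (rnormB _ _) _.
    have h1 := rnorm_dotp_le (tpi a u) y.
    have h2 := rnorm_dotp_le u (tpi (cstar a) y).
    have h3 : rnorm (tpi a u) * rnorm y <= M * rnorm u * rnorm y.
      by rewrite ler_wpM2r ?rnorm_ge0.
    have h4 : rnorm u * rnorm (tpi (cstar a) y) <= rnorm u * (M' * rnorm y).
      by rewrite ler_wpM2l ?rnorm_ge0.
    lra.
  move=> xi cxi.
  apply: (L2_dense_eq0
    (phi := fun y => dotp (tpi a (iota xi)) y - dotp (iota xi) (tpi (cstar a) y)
      : R[i])
    (M := 2 * rnorm (tpi a (iota xi)) + 2 * M' * rnorm (iota xi))).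
  + by move=> u v; rewrite sB !dBr reorder.
  + move=> u; apply: le_trans (rnormB _ _) _.
    have h1 := rnorm_dotp_le (tpi a (iota xi)) u.
    have h2 := rnorm_dotp_le (iota xi) (tpi (cstar a) u).
    have h4 : rnorm (iota xi) * rnorm (tpi (cstar a) u) <=
      rnorm (iota xi) * (M' * rnorm u).
      by rewrite ler_wpM2l ?rnorm_ge0.
    lra.
  move=> eta ceta; apply/eqP; rewrite subr_eq0; apply/eqP.
  rewrite !tpi_iota // !(L2_dotp hL) //; try exact: Cc_regular.
  congr (cintegral _ _); apply/funext => t.
  by rewrite (rep_cstar rp) (staraut_cstar (action_aut actG _)).
Qed.

End RegularRepresentation.
End L2Space.

(** * The factorization *)

Section CompleteContractions.
Variables (R : realType) (A B : cstarAlgType R).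

Lemma linear_exists (f : A -> B) : linear f ->
  exists F : {linear A -> B}, forall x, F x = f x.
Proof.
move=> lf.
pose F : {linear A -> B} := HB.pack f (GRing.isLinear.Build _ _ _ _ f lf).
by exists F.
Qed.

(** A faithful representation of the target computes its matrix norms, which leaves an estimate on
    vectors. *)
Lemma completely_contractive_rep (L : hilbertType R) (rho : B -> L -> L)
    (S : {linear A -> B}) : faithful_representation rho ->
  (forall n, is_cstar_mxnorm (@cstar_mxnorm R A n)) ->
  (forall n (x : 'M[A]_n) v,
    form_norm (amp_form (@re_dotp R L) (n := n)) (amp_rep rho (map_mx S x) v) <=
    Re (cstar_mxnorm x) * form_norm (amp_form (@re_dotp R L) (n := n)) v) ->
  completely_contractive S.
Proof.
move=> [rep_rho inj_rho] hA hS n x.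
rewrite (cstar_mxnormE rep_rho inj_rho).
have xE := ge0_ReE (mxnorm_ge0 (hA n) x).
rewrite xE lecR; apply: op_norm_le; last exact: hS.
by rewrite -lecR -xE (mxnorm_ge0 (hA n)).
Qed.

End CompleteContractions.

Lemma amp_norm_le (R : realType) (H L : hilbertType R) n
    (x : {ffun 'I_n -> H}) (y : {ffun 'I_n -> L}) :
  (forall i, rnorm (x i) <= rnorm (y i)) ->
  form_norm (amp_form (@re_dotp R H) (n := n)) x <=
  form_norm (amp_form (@re_dotp R L) (n := n)) y.
Proof.
move=> xy; apply: ler_wsqrtr; apply: ler_sum => i _.
by rewrite !re_dotpxx ler_pXn2r ?nnegrE ?rnorm_ge0.
Qed.

Section Factorization.
Variables (R : realType) (G : topologicalGroupType).
Hypothesis hausdorffG : hausdorff_space G.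
Variable mu : {measure set (borel G) -> \bar R}.
Hypothesis haar_mu : left_haar_measure mu.
Variables (H L : hilbertType R) (iota : (G -> H) -> L).
Hypothesis hL : is_L2 mu iota.
Variables (A : cstarAlgType R) (alpha : G -> A -> A).
Hypothesis actG : strongly_continuous_action alpha.
Variables (pi : A -> H -> H) (tpi : A -> L -> L) (lam : G -> L -> L).
Hypothesis faithful_pi : faithful_representation pi.
Hypothesis htpi : is_regular_representation alpha pi iota tpi.
Hypothesis hlam : is_left_translation iota lam.

Let rp : is_representation pi := proj1 faithful_pi.
Let srp := representation_star_rep rp.
Let rtpi : is_representation tpi :=
  regular_is_representation hausdorffG hL actG rp htpi.

Let int (g : G -> R) (cg : CcR g) :=
  CcR_integrable hausdorffG haar_mu cg measurableT.

Lemma cintegral_dotp (K : hilbertType R) (v : K) (F : G -> K) :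
  (forall k, re_dotp v k = \int[mu]_t re_dotp (F t) k) ->
  forall k, dotp v k = cintegral mu (fun t => dotp (F t) k).
Proof.
move=> vF k; apply/eqP; rewrite eq_complex /=; apply/andP; split; apply/eqP.
  exact: vF.
rewrite -re_dotp_i vF; congr (Rintegral _ _ _); apply/funext => t.
exact: re_dotp_i.
Qed.

Section Averaging.
Variable h : G -> R.
Hypotheses (ch : CcR h) (h0 : forall t, 0 <= h t) (h1 : \int[mu]_t h t = 1).

Lemma averaging_operator : exists C : L -> L, [/\ linear C,
  forall k k', re_dotp (C k) k' = \int[mu]_s (h s * re_dotp (lam s k) k') &
  forall k, rnorm (C k) <= rnorm k].
Proof.
have cF k : Cc (fun s => (h s)%:C *: lam s k).
  by apply: (Cc_scale hausdorffG (CcR_Cc hausdorffG ch));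
    exact: (lam_continuous hausdorffG haar_mu hL hlam).
have /choice[C CP] k := hilbert_integral hausdorffG haar_mu (cF k).
have CE k k' : re_dotp (C k) k' = \int[mu]_s (h s * re_dotp (lam s k) k').
  by rewrite CP; congr (Rintegral _ _ _); apply/funext => s; rewrite re_dotpZl.
have cre k k' : CcR (fun s => h s * re_dotp (lam s k) k').
  have := CcR_re_dotp hausdorffG k' (cF k).
  by congr CcR; apply/funext => s; rewrite re_dotpZl.
have blam s := bounded_operatorP (proj1 (hlam s)).
have CD k l : C (k + l) = C k + C l.
  apply: re_dotp_inj => k'; rewrite re_dotpDl !CE -RintegralD //;
    try (apply: int; exact: cre).
  congr (Rintegral _ _ _); apply/funext => s.
  by have [lD _ _ _] := blam s; rewrite lD re_dotpDl mulrDr.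
have CZ (z : R[i]) k : C (z *: k) = z *: C k.
  have dual v k' : re_dotp (z *: v : L) k' = re_dotp v ((z^*)%R *: k').
    by rewrite /re_dotp dotpZl dotpZr conjCK.
  apply: re_dotp_inj => k'; rewrite dual !CE.
  congr (Rintegral _ _ _); apply/funext => s.
  by have [_ _ lZ _] := blam s; rewrite lZ dual.
exists C; split => //; first by move=> z k l; rewrite CD CZ.
move=> k; have [Ck0|Ck0] := eqVneq (rnorm (C k)) 0;
  first by rewrite Ck0 rnorm_ge0.
have Cpos : 0 < rnorm (C k) by rewrite lt_def Ck0 rnorm_ge0.
(* Testing against [C k] itself: [|C k|^2] is the average of [Re <lam s k, C k>] for the probability
   density [h], hence at most [|k| |C k|]. *)
rewrite -(ler_pM2r Cpos) -expr2 -re_dotpxx CE.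
rewrite -[leRHS]mulr1 -h1 -RintegralZl //; last exact: int.
apply: le_Rintegral => //; first by apply: int; exact: cre.
  by apply: int; exact: CcR_scale.
move=> s _; rewrite mulrC ler_wpM2r //.
apply: le_trans (re_dotp_le _ _) _; rewrite ler_wpM2r ?rnorm_ge0 //.
exact: (lam_le hausdorffG haar_mu hL hlam).
Qed.

Lemma averaged_generator (C : L -> L) (a : A) : linear C ->
  (forall k k', re_dotp (C k) k' = \int[mu]_s (h s * re_dotp (lam s k) k')) ->
  (forall k, rnorm (C k) <= rnorm k) ->
  closed_span (crossed_product_generator mu tpi lam) (fun k => tpi a (C k)).
Proof.
move=> linC CE C1.
have bX : bounded_operator (fun k => tpi a (C k)).
  split; first by move=> z k l; rewrite linC (repD rtpi) (repZ rtpi).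
  exists (rnorm a)%:C; split; first by rewrite ler0c rnorm_ge0.
  move=> k; rewrite !rnormE -rmorphM lecR.
  by apply: le_trans (rep_contractive rtpi _ _) _; rewrite ler_wpM2l ?rnorm_ge0.
have gX : crossed_product_generator mu tpi lam (fun k => tpi a (C k)).
  split => //; exists (fun s => (h s)%:C), a; split; first exact: CcR_Cc.
  move=> k k'.
  rewrite (@cintegral_dotp _ _ (fun s => (h s)%:C *: tpi a (lam s k))) => [|l].
    by congr (cintegral _ _); apply/funext => s; rewrite dotpZl.
  (* Passing to the adjoint brings [tpi a] under the weak integral, so that [tpi(a) C] is a
     generator with weight [h]. *)
  have adj v : re_dotp (tpi a v) l = re_dotp v (tpi (cstar a) l).
    by rewrite /re_dotp (rep_cstar rtpi).
  rewrite adj CE; congr (Rintegral _ _ _); apply/funext => s.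
  by rewrite re_dotpZl adj.
split => // e e0.
exists (fun k => \sum_(i < 1) (1 : R[i]) *: tpi a (C k)).
  exact: (@in_span_comb R L _ 1 (fun=> 1) (fun _ k => tpi a (C k))).
split; first exact: ltW.
move=> k; rewrite big_ord1 scale1r subrr normr0.
by rewrite mulr_ge0 // ltW.
Qed.

End Averaging.

(** * Compression of the crossed product to [A] *)

Section Compression.
Variable f : G -> R.
Hypotheses (cf : CcR f) (f1 : \int[mu]_t (f t ^+ 2) = 1).

(** The isometry [V] of the overview. *)
Definition embed (x : H) : L := iota (fun t => (f t)%:C *: x).

Lemma Cc_embed (x : H) : Cc (fun t => (f t)%:C *: x).
Proof. by apply: (Cc_scale hausdorffG (CcR_Cc hausdorffG cf)) => t;
  exact: cvg_cst. Qed.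

Lemma embed_linear (z : R[i]) x y : embed (z *: x + y) = z *: embed x + embed y.
Proof.
rewrite /embed -(L2_linear hL); try exact: Cc_embed.
congr iota; apply/funext => t.
by rewrite scalerDr !scalerA mulrC.
Qed.

Lemma embed_norm x : rnorm (embed x) = rnorm x.
Proof.
apply/eqP; rewrite -(eqrXn2 (n := 2)) ?rnorm_ge0 //; apply/eqP.
rewrite (L2_norm hL); last exact: Cc_embed.
rewrite -[RHS]mulr1 -f1 -RintegralZl //; last by apply: int; exact: CcR_sqr.
congr (Rintegral _ _ _); apply/funext => t.
by rewrite rnormZ rnormR exprMn real_normK ?num_real // mulrC.
Qed.

Lemma embedD x y : embed (x + y) = embed x + embed y.
Proof. by have := embed_linear 1 x y; rewrite !scale1r. Qed.

Lemma embedZ (z : R[i]) x : embed (z *: x) = z *: embed x.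
Proof.
have e0 : embed 0 = 0 by apply: (@addrI _ (embed 0)); rewrite -embedD !addr0.
by have := embed_linear z x 0; rewrite e0 !addr0.
Qed.

(** The bound does not depend on [x]: translates of [embed] vary continuously in operator norm,
    whereas [lam_continuous] is only strong continuity. *)
Lemma embed_translate_le (s r : G) x : rnorm x <= 1 ->
  rnorm (lam s (embed x) - lam r (embed x)) ^+ 2 <=
  \int[mu]_t (rnorm ((f (s^-1 * r * t)%g)%:C - (f t)%:C : R[i]^o) ^+ 2).
Proof.
move=> x1; have cfC : Cc ((fun t => (f t)%:C) : G -> R[i]^o) by exact: CcR_Cc.
rewrite (lam_iotaB_norm hausdorffG haar_mu hL hlam); last exact: Cc_embed.
apply: le_Rintegral => //.
- apply: int; apply: CcR_sqr; apply: CcR_rnorm => //; apply: Cc_sub => //.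
    by have := Cc_translate hausdorffG (s^-1 * r)^-1%g (Cc_embed x);
      rewrite invgK.
  exact: Cc_embed.
- apply: int; apply: CcR_sqr.
  apply: (@CcR_rnorm R G hausdorffG R[i]^o
    (fun t => (f (s^-1 * r * t)%g)%:C - (f t)%:C)).
  apply: (Cc_sub hausdorffG) => //.
  by have := Cc_translate hausdorffG (s^-1 * r)^-1%g cfC; rewrite invgK.
- move=> t _; rewrite -scalerBl rnormZ exprMn ler_piMr ?sqr_ge0 //.
  by rewrite expr_le1 ?rnorm_ge0.
Qed.

(* [V^* X V = pi a], where [V] is [embed]. *)
Definition compresses_to (X : L -> L) (a : A) : Prop :=
  forall x y, dotp (pi a x) y = dotp (X (embed x)) (embed y).

Lemma compresses_to_re X a :
  (forall x y, re_dotp (pi a x) y = re_dotp (X (embed x)) (embed y)) ->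
  compresses_to X a.
Proof. by move=> aX x y; apply: eq_dotp => z; rewrite aX embedZ. Qed.

(** The compression is the integral of [f(t) f(s^-1 t) alpha_{t^-1}(a)], a continuous compactly
    supported function of [t] with values in [A]. *)
Lemma compress_translate (a : A) (s : G) :
  exists b, compresses_to (fun k => tpi a (lam s k)) b.
Proof.
pose w t := f t * f (s^-1 * t)%g.
have cw : CcR w.
  have [cf' [K cK fK]] := cf; split.
    move=> t; apply: continuousM; first exact: cf'.
    by apply: continuous_comp; [exact: translate_continuous | exact: cf'].
  by exists K => // t /fK; rewrite /w => ->; rewrite mul0r.
have cF : Cc (fun t => (w t)%:C *: alpha (t^-1)%g a).
  apply: (Cc_scale hausdorffG (CcR_Cc hausdorffG cw)).
  exact: (action_inv_continuous actG).
have [b bP] := faithful_integral hausdorffG haar_mu faithful_pi cF.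
exists b; apply: compresses_to_re => x y; rewrite bP.
have ctr : Cc (fun t => (f (s^-1 * t)%g)%:C *: x).
  exact: (Cc_translate hausdorffG s (Cc_embed x)).
rewrite /embed (lam_iota hlam); last exact: Cc_embed.
rewrite (tpi_iota htpi) // (L2_re_dotp hL); first last.
- exact: Cc_embed.
- exact: (Cc_regular hausdorffG actG rp).
congr (Rintegral _ _ _); apply/funext => t.
by rewrite (srepZ srp) (repZ rp) re_dotpZr !re_dotpZl mulrA.
Qed.

Lemma compress_bound X Y a b (c : R) : 0 <= c ->
  compresses_to X a -> compresses_to Y b ->
  (forall x, rnorm x <= 1 -> rnorm (X (embed x) - Y (embed x)) <= c) ->
  rnorm (a - b) <= c.
Proof.
move=> c0 Xa Yb XY; apply: (faithful_norming faithful_pi c0) => x y x1 y1.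
rewrite (srepD srp) -scaleN1r (srepZ srp) scaleN1r re_dotpBl /re_dotp Xa Yb.
rewrite -[Re _ - Re _]/(re_dotp _ _ - re_dotp _ _) -re_dotpBl.
apply: le_trans (re_dotp_le _ _) _; rewrite embed_norm.
rewrite -[leRHS]mulr1; apply: ler_pM; rewrite ?rnorm_ge0 //; exact: XY.
Qed.

(** If [b s] denotes the compression of [tpi a] composed with [lam s], that of [X] is the integral
    of [g s *: b s]. It exists in [A] because [b] is norm continuous, by the uniform bound on
    translates of [embed]. *)
Lemma compress_generator X : crossed_product_generator mu tpi lam X ->
  exists a, compresses_to X a.
Proof.
move=> [bX [g [a [cg XE]]]].
have /choice[b bP] := compress_translate a.
have cfC : Cc ((fun t => (f t)%:C) : G -> R[i]^o) by exact: CcR_Cc.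
have cb : continuous b.
  apply/rnorm_continuousP => r e e0.
  pose d := e / (rnorm a + 2).
  have a0 := rnorm_ge0 a.
  have a2 : 0 < rnorm a + 2 by lra.
  have d0 : 0 < d by exact: divr_gt0.
  have d20 : 0 < d ^+ 2 by rewrite exprn_gt0.
  have := near_translate r (integral_translate_near hausdorffG haar_mu cfC d20).
  apply: filterS => s Hs.
  have lt : rnorm a * d < e.
    have -> : e = (rnorm a + 2) * d by rewrite /d mulrC mulfVK // gt_eqF.
    by rewrite ltr_pM2r //; lra.
  apply: le_lt_trans lt.
  apply: (compress_bound _ (bP s) (bP r)); first by rewrite mulr_ge0 // ltW.
  move=> x x1.
  have tB u v : tpi a (u - v) = tpi a u - tpi a v.
    by rewrite (repD rtpi) -scaleN1r (repZ rtpi) scaleN1r.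
  rewrite -tB; apply: le_trans (rep_contractive rtpi _ _) _.
  rewrite ler_wpM2l // -(ler_pXn2r (n := 2)) ?nnegrE ?rnorm_ge0 ?(ltW d0) //.
  by apply: le_trans Hs; exact: embed_translate_le.
have cF : Cc (fun s => g s *: b s) by apply: (Cc_scale hausdorffG).
have [c cP] := faithful_integral hausdorffG haar_mu faithful_pi cF.
exists c; apply: compresses_to_re => x y; rewrite cP.
rewrite /re_dotp XE /=; congr (Rintegral _ _ _); apply/funext => s.
by rewrite (srepZ srp) dotpZl bP.
Qed.

Lemma compress_span X : in_span (crossed_product_generator mu tpi lam) X ->
  exists a, compresses_to X a.
Proof.
move=> [n c Y YP].
have /choice[a aP] i := compress_generator (YP i).
exists (\sum_i c i *: a i) => x y.
rewrite (sum_rep rp).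
have suml (K : hilbertType R) (F : 'I_n -> K) w :
    dotp (\sum_i F i) w = \sum_i dotp (F i) w.
  by apply: (big_morph (fun v => dotp v w)) => [u v|]; rewrite ?dotpDl ?dotp0l.
rewrite !suml; apply: eq_bigr => i _.
by rewrite (srepZ srp) !dotpZl aP.
Qed.

(** Compression does not increase norms, so the compressions of approximants of [X] in the span form
    a Cauchy sequence in [A], and its limit compresses [X]. *)
Lemma compress_closed_span X :
  closed_span (crossed_product_generator mu tpi lam) X ->
  exists a, compresses_to X a.
Proof.
move=> [bX XP].
have q01 : 0 <= (2^-1 : R) < 1 by rewrite invr_ge0 ler0n invf_lt1 ?ltr1n.
have e0 n : 0 < (2^-1 : R) ^+ n by rewrite exprn_gt0 // invr_gt0.
have /choice[u uP] (n : nat) : exists a, forall x y,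
    `|re_dotp (pi a x) y - re_dotp (X (embed x)) (embed y)| <=
    2^-1 ^+ n * (rnorm x * rnorm y).
  have [|Y YP [_ XY]] := XP ((2^-1 ^+ n)%:C); first by rewrite ltcR.
  have [a aP] := compress_span YP.
  exists a => x y; rewrite /re_dotp aP distrC
    -[Re _ - Re _]/(re_dotp _ _ - re_dotp _ _).
  rewrite -re_dotpBl; apply: le_trans (normr_re_dotp_le _ _) _.
  rewrite mulrA embed_norm ler_wpM2r ?rnorm_ge0 //.
  have := XY (embed x); rewrite !rnormE -rmorphM lecR embed_norm.
  exact.
have piB a b x : pi (a - b) x = pi a x - pi b x.
  by rewrite (srepD srp) -scaleN1r (srepZ srp) scaleN1r.
have bnd n k : (n <= k)%N -> rnorm (u n - u k) <= 2 * 2^-1 ^+ n.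
  move=> nk; apply: (faithful_norming faithful_pi) => [|x y x1 y1].
    by rewrite mulr_ge0 // ltW.
  rewrite piB re_dotpBl.
  have xy : rnorm x * rnorm y <= 1 * 1 by apply: ler_pM; rewrite ?rnorm_ge0.
  have kn : (2^-1 : R) ^+ k <= 2^-1 ^+ n.
    by apply: ler_wiXn2l => //; have /andP[? /ltW] := q01.
  have h1 : 2^-1 ^+ n * (rnorm x * rnorm y) <= 2^-1 ^+ n * (1 * 1).
    by rewrite ler_pM2l.
  have h2 : 2^-1 ^+ k * (rnorm x * rnorm y) <= 2^-1 ^+ k * (1 * 1).
    by rewrite ler_pM2l.
  have := uP n x y; have := uP k x y.
  rewrite !ler_norml => /andP[? ?] /andP[? ?]; lra.
have [|a aP] := @rnorm_complete R A u.
  move=> e e0'; have [n Hn] := geometric_small 4 q01 e0'.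
  exists n => i j ni nj; rewrite -(subrKA (u n)).
  apply: le_lt_trans (rnormD _ _) _; rewrite (rnormBC (u i)).
  have := bnd _ _ ni; have := bnd _ _ nj; lra.
exists a; apply: compresses_to_re => x y.
apply/eqP; rewrite -subr_eq0 -normr_eq0 eq_le normr_ge0 andbT.
apply/ler_addgt0Pr => e e0'; rewrite add0r.
pose K := rnorm x * rnorm y + 1.
have xy0 : 0 <= rnorm x * rnorm y by rewrite mulr_ge0 ?rnorm_ge0.
have K0 : 0 < K by rewrite /K; lra.
have d0 : 0 < e / (2 * K) by rewrite divr_gt0 // mulr_gt0.
have [n Hn] := geometric_small 1 q01 d0; rewrite mul1r in Hn.
have [k Hk] := aP _ d0.
pose j := maxn n k.
have jn : (2^-1 : R) ^+ j <= 2^-1 ^+ n.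
  by apply: ler_wiXn2l; [have /andP[] := q01|have /andP[_ /ltW] :=
    q01|exact: leq_maxl].
have h1 := uP j x y.
have h2 : `|re_dotp (pi (u j) x) y - re_dotp (pi a x) y| <=
  e / (2 * K) * (rnorm x * rnorm y).
  rewrite -re_dotpBl -piB; apply: le_trans (normr_re_dotp_le _ _) _.
  rewrite mulrA ler_wpM2r ?rnorm_ge0 //.
  apply: le_trans (rep_contractive rp _ _) _; rewrite ler_wpM2r ?rnorm_ge0 //.
  exact/ltW/Hk/leq_maxr.
have h3 : 2^-1 ^+ j * (rnorm x * rnorm y) <= e / (2 * K) * (rnorm x * rnorm y).
  by rewrite ler_wpM2r // (le_trans jn) // ltW.
have h4 : e / (2 * K) * (rnorm x * rnorm y) <= e / 2.
  have -> : e / 2 = e / (2 * K) * K by field; rewrite gt_eqF.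
  by rewrite ler_pM2l // /K; lra.
move: h1 h2; rewrite !ler_norml => /andP[? ?] /andP[? ?]; apply/andP; split;
  lra.
Qed.

End Compression.
Variables (B : cstarAlgType R) (rho : B -> L -> L).
Hypothesis faithful_rho : faithful_representation rho.
Hypothesis range_rho : range rho =
  closed_span (crossed_product_generator mu tpi lam).

Let rrho : is_representation rho := proj1 faithful_rho.
Let srho := representation_star_rep rrho.

(** After amplification, [S] becomes the amplified [tpi] composed with [C] in each coordinate: a
    contractive representation after a contraction. *)
Lemma exists_averaging_map (C : L -> L) (h : G -> R) : CcR h ->
  linear C ->
  (forall k k', re_dotp (C k) k' = \int[mu]_s (h s * re_dotp (lam s k) k')) ->
  (forall k, rnorm (C k) <= rnorm k) ->
  exists S : {linear A -> B}, completely_contractive S /\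
    forall a k, rho (S a) k = tpi a (C k).
Proof.
move=> ch linC CE C1.
have /choice[S0 S0P] a : exists b, rho b = (fun k => tpi a (C k)).
  have := averaged_generator ch a linC CE C1.
  by rewrite -range_rho => -[b _ bE]; exists b.
have linS : linear S0.
  move=> z a b; apply: (proj2 faithful_rho); apply/funext => k.
  by rewrite (srepD srho) (srepZ srho) !S0P (rep_linear rtpi).
have [S SE] := linear_exists linS.
have SP a k : rho (S a) k = tpi a (C k) by rewrite SE S0P.
have hA n := is_cstar_mxnorm_cstar_mxnorm rp (proj2 faithful_pi) n.
exists S; split => //; apply: (completely_contractive_rep faithful_rho hA) => n
  x v.
pose Cv : {ffun 'I_n -> L} := [ffun i => C (v i)].
have -> : amp_rep rho (map_mx S x) v = amp_rep tpi x Cv.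
  apply/ffunP => i; rewrite !ffunE; apply: eq_bigr => j _.
  by rewrite mxE SP ffunE.
apply: le_trans (is_cstar_mxnorm_rep rtpi (hA n) x Cv) _.
have xE := ge0_ReE (mxnorm_ge0 (hA n) x).
apply: ler_wpM2l; first by rewrite -lecR -xE (mxnorm_ge0 (hA n)).
by apply: amp_norm_le => i; rewrite ffunE.
Qed.

(** For [w = T_n(x) v], moving the embedding across the inner product gives
    [|w|^2 = Re <rho_n(x) V v, V w>], at most [|x| |v| |w|]. *)
Lemma exists_compression_map (f : G -> R) : CcR f ->
  \int[mu]_t (f t ^+ 2) = 1 ->
  exists T : {linear B -> A}, completely_contractive T /\
    forall b, compresses_to f (rho b) (T b).
Proof.
move=> cf f1.
have /choice[T0 T0P] b : exists a, compresses_to f (rho b) a.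
  by apply: compress_closed_span => //; rewrite -range_rho; exists b.
have linT : linear T0.
  move=> z b c; apply: (proj2 faithful_pi); apply/funext => x.
  apply: re_dotp_inj => y; rewrite /re_dotp T0P.
  rewrite (srepD srho) (srepZ srho) dotpDl dotpZl (srepD srp) (srepZ srp).
  by rewrite dotpDl dotpZl !T0P.
have [T TE] := linear_exists linT.
have TP b : compresses_to f (rho b) (T b) by rewrite TE; exact: T0P.
have hB n := is_cstar_mxnorm_cstar_mxnorm rrho (proj2 faithful_rho) n.
exists T; split => //; apply: (completely_contractive_rep faithful_pi hB) => n x
  v.
set w := amp_rep pi (map_mx T x) v.
pose Ev (u : {ffun 'I_n -> H}) : {ffun 'I_n -> L} := [ffun i => embed f (u i)].
have Enorm u : form_norm (amp_form (@re_dotp R L) (n := n)) (Ev u) <=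
    form_norm (amp_form (@re_dotp R H) (n := n)) u.
  by apply: amp_norm_le => i; rewrite ffunE embed_norm.
have fH := amp_real_form n (@re_dotp_form R H).
have fL := amp_real_form n (@re_dotp_form R L).
have ww : form_norm (amp_form (@re_dotp R H) (n := n)) w ^+ 2 =
    amp_form (@re_dotp R L) (amp_rep rho x (Ev v)) (Ev w).
  rewrite (form_norm_sqr fH); apply: eq_bigr => i _.
  rewrite {1}/w !ffunE.
  have suml (K : hilbertType R) (F : 'I_n -> K) y :
      re_dotp (\sum_i F i) y = \sum_i re_dotp (F i) y.
    by apply: (big_morph (fun v => re_dotp v y)) => [a b|];
      rewrite ?re_dotpDl // /re_dotp dotp0l.
  by rewrite !suml; apply: eq_bigr => j _; rewrite mxE ffunE /re_dotp TP.
have x0 : 0 <= Re (cstar_mxnorm x).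
  by rewrite -lecR -(ge0_ReE (mxnorm_ge0 (hB n) x)) (mxnorm_ge0 (hB n)).
have [w0|w0] := eqVneq (form_norm (amp_form (@re_dotp R H) (n := n)) w) 0.
  by rewrite w0 mulr_ge0 // form_norm_ge0.
have wpos : 0 < form_norm (amp_form (@re_dotp R H) (n := n)) w.
  by rewrite lt_def w0 form_norm_ge0.
rewrite -(ler_pM2r wpos) -expr2 ww.
apply: le_trans (form_cauchy_schwarz fL _ _) _.
apply: ler_pM; rewrite ?form_norm_ge0 //.
apply: le_trans (is_cstar_mxnorm_rep rrho (hB n) x (Ev v)) _.
exact: ler_wpM2l.
Qed.

(* [pi (T (S a))] is the average of the compressions of [tpi a \o lam s] with
   respect to the probability density [h]. *)
Lemma factorization_estimate (f h : G -> R) (C : L -> L) (S : A -> B)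
  (T : B -> A)
    (a : A) (d : R) : 0 < d ->
  CcR f -> \int[mu]_t (f t ^+ 2) = 1 ->
  CcR h -> (forall s, 0 <= h s) -> \int[mu]_s h s = 1 ->
  (forall k k', re_dotp (C k) k' = \int[mu]_s (h s * re_dotp (lam s k) k')) ->
  (forall k, rho (S a) k = tpi a (C k)) ->
  (forall b, compresses_to f (rho b) (T b)) ->
  (forall t, f t != 0 -> rnorm (alpha (t^-1)%g a - a) <= d) ->
  (forall s x, h s != 0 -> rnorm x <= 1 ->
     rnorm a * rnorm (lam s (embed f x) - embed f x) <= d) ->
  rnorm (T (S a) - a) <= 2 * d.
Proof.
move=> d0 cf f1 ch h0 h1 CE SE TE near_alpha near_lam.
have d20 : 0 <= 2 * d by rewrite mulr_ge0 // ltW.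
apply: (faithful_norming faithful_pi d20) => x y x1 y1.
rewrite (srepD srp) -scaleN1r (srepZ srp) scaleN1r re_dotpBl.
rewrite {1}/re_dotp TE SE -[Re _]/(re_dotp _ _).
have adj k k' : re_dotp (tpi a k) k' = re_dotp k (tpi (cstar a) k').
  by rewrite /re_dotp (rep_cstar rtpi).
rewrite adj CE.
have -> : re_dotp (pi a x) y = \int[mu]_s (re_dotp (pi a x) y * h s).
  by rewrite RintegralZl ?h1 ?mulr1 //; exact: int.
have cy (z : L) : CcR (fun s => h s * re_dotp (lam s (embed f x)) z).
  have cF : Cc (fun s => (h s)%:C *: lam s (embed f x)).
    apply: (Cc_scale hausdorffG (CcR_Cc hausdorffG ch)).
    exact: (lam_continuous hausdorffG haar_mu hL hlam).
  have := CcR_re_dotp hausdorffG z cF.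
  by congr CcR; apply/funext => s; rewrite re_dotpZl.
have ci1 := int (cy (tpi (cstar a) (embed f y))).
have ci2 := int (CcR_scale (re_dotp (pi a x) y) ch).
rewrite -RintegralB //.
rewrite -[leRHS]mulr1 -[X in _ <= _ * X]h1 -RintegralZl //; last exact: int.
(* Without translation, compressing [tpi a] averages [alpha_{t^-1}(a)] with the probability density
   [f^2], whose support lies where [alpha_{t^-1}(a)] is within [d] of [a]. *)
have emb : re_dotp (tpi a (embed f x)) (embed f y) - re_dotp (pi a x) y <= d.
  have cx := Cc_embed cf x; have cy' := Cc_embed cf y.
  have cfi := int (CcR_sqr cf).
  have -> : re_dotp (pi a x) y = \int[mu]_t (re_dotp (pi a x) y * f t ^+ 2).
    by rewrite RintegralZl ?f1 ?mulr1.
  rewrite (tpi_iota htpi a cx) (L2_re_dotp hL) //;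
    last exact: (Cc_regular hausdorffG actG rp).
  have ci3 : CcR (fun t => f t ^+ 2 * re_dotp (pi (alpha (t^-1)%g a) x) y).
    have cF : Cc (fun t => (f t)%:C *: pi (alpha (t^-1)%g a) ((f t)%:C *: x)).
      apply: (Cc_scale hausdorffG (CcR_Cc hausdorffG cf)).
      by have [] := Cc_regular hausdorffG actG rp a cx.
    have := CcR_re_dotp hausdorffG y cF.
    by congr CcR; apply/funext => t; rewrite (repZ rp) !re_dotpZl mulrA.
  have -> : (fun t => re_dotp (pi (alpha (t^-1)%g a) ((f t)%:C *: x))
    ((f t)%:C *: y)) =
      (fun t => f t ^+ 2 * re_dotp (pi (alpha (t^-1)%g a) x) y).
    by apply/funext => t; rewrite (repZ rp) re_dotpZr re_dotpZl mulrA.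
  rewrite -RintegralB //; [|exact: int|by apply: int;
    exact: CcR_scale (CcR_sqr cf)].
  rewrite -[leRHS]mulr1 -f1 -RintegralZl //.
  have ci4 := CcR_scale (re_dotp (pi a x) y) (CcR_sqr cf).
  apply: le_Rintegral => //.
  - exact: (integrableB measurableT (int ci3) (int ci4)).
  - by apply: int; exact: CcR_scale (CcR_sqr cf).
  - move=> t _; rewrite mulrC -mulrBl -re_dotpBl.
    have [->|ft] := eqVneq (f t) 0; first by rewrite expr0n /= !mulr0.
    rewrite ler_wpM2r ?sqr_ge0 //.
    rewrite -scaleN1r -(srepZ srp) -(srepD srp) scaleN1r.
    apply: le_trans (re_dotp_le _ _) _.
    rewrite -[leRHS]mulr1; apply: ler_pM; rewrite ?rnorm_ge0 //.
    apply: le_trans (rep_contractive rp _ _) _.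
    by rewrite -[leRHS]mulr1; apply: ler_pM; rewrite ?rnorm_ge0 ?near_alpha.
apply: le_Rintegral => //.
- exact: (integrableB measurableT ci1 ci2).
- by apply: int; exact: CcR_scale.
move=> s _; rewrite mulrC -mulrBl.
have [->|hs] := eqVneq (h s) 0; first by rewrite !mulr0.
rewrite ler_wpM2r // -adj.
(* Separates the error caused by the translation, bounded through [near_lam], from the one caused by
   the action, bounded by [emb]. *)
have -> : re_dotp (tpi a (lam s (embed f x))) (embed f y) - re_dotp (pi a x) y =
    re_dotp (tpi a (lam s (embed f x) - embed f x)) (embed f y) +
    (re_dotp (tpi a (embed f x)) (embed f y) - re_dotp (pi a x) y).
  have tB u v : tpi a (u - v) = tpi a u - tpi a v.
    by rewrite (repD rtpi) -scaleN1r (repZ rtpi) scaleN1r.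
  by rewrite tB re_dotpBl subrKA.
have : re_dotp (tpi a (lam s (embed f x) - embed f x)) (embed f y) <= d.
  apply: le_trans (re_dotp_le _ _) _; rewrite embed_norm //.
  rewrite -[leRHS]mulr1; apply: ler_pM; rewrite ?rnorm_ge0 //.
  apply: le_trans (rep_contractive rtpi _ _) _; exact: near_lam.
lra.
Qed.

End Factorization.

(** * Normalized bump functions and the conclusion *)

Section NormalizedBump.
Variables (R : realType) (G : topologicalGroupType).
Hypotheses (hausdorffG : hausdorff_space G) (lcG : locally_compact [set: G]).
Variable mu : {measure set (borel G) -> \bar R}.
Hypothesis haar_mu : left_haar_measure mu.

Lemma bump_integral1 (W : set G) : nbhs (1%g : G) W ->
  exists h : G -> R, [/\ CcR h, forall t, 0 <= h t, \int[mu]_t h t = 1 &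
    forall t, h t != 0 -> W t].
Proof.
move=> W1; have [g [cg g0 g1 gW]] := bump_function R hausdorffG lcG W1.
have I0 := integral_gt0 hausdorffG haar_mu cg g0 g1.
exists (fun t => (\int[mu]_s g s)^-1 * g t); split.
- exact: CcR_scale.
- by move=> t; rewrite mulr_ge0 // invr_ge0 ltW.
- rewrite RintegralZl //; last exact: (CcR_integrable hausdorffG haar_mu cg).
  by rewrite mulVf // gt_eqF.
- move=> t; apply: contraPP => /gW ->; rewrite mulr0 eqxx; exact.
Qed.

Lemma bump_integral_sqr1 (W : set G) : nbhs (1%g : G) W ->
  exists f : G -> R, [/\ CcR f, \int[mu]_t (f t ^+ 2) = 1 &
    forall t, f t != 0 -> W t].
Proof.
move=> W1; have [g [cg g0 g1 gW]] := bump_function R hausdorffG lcG W1.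
have cg2 := CcR_sqr cg.
have I0 := integral_gt0 hausdorffG haar_mu cg2 (fun t => sqr_ge0 (g t))
  (exprn_gt0 2 g1).
exists (fun t => (Num.sqrt (\int[mu]_s (g s ^+ 2)))^-1 * g t); split.
- exact: CcR_scale.
- under eq_Rintegral do rewrite exprMn.
  rewrite RintegralZl //; last exact: (CcR_integrable hausdorffG haar_mu cg2).
  by rewrite exprVn sqr_sqrtr ?(ltW I0) // mulVf // gt_eqF.
- move=> t; apply: contraPP => /gW ->; rewrite mulr0 eqxx; exact.
Qed.

End NormalizedBump.

(** [alpha 1] is idempotent and injective, hence the identity. *)
Lemma action1 (R : realType) (G : topologicalGroupType) (A : cstarAlgType R)
    (alpha : G -> A -> A) : strongly_continuous_action alpha ->
  forall a, alpha 1%g a = a.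
Proof.
move=> actG a; apply: (bij_inj (staraut_bij (action_aut actG 1%g))).
by rewrite -(actionM actG) mulg1.
Qed.

Lemma opnorm_faithful (R : realType) (B : cstarAlgType R) (L : hilbertType R)
    (rho : B -> L -> L) : is_representation rho ->
  (forall b, is_opnorm (rho b) `|b|) -> faithful_representation rho.
Proof.
move=> rrho opn; split => // b c bc.
have srho := representation_star_rep rrho.
apply/eqP; rewrite -subr_eq0 -normr_eq0 eq_le normr_ge0 andbT.
apply: (proj2 (opn (b - c))); split => // x.
rewrite (srepD srho) -scaleN1r (srepZ srho) scaleN1r bc subrr normr0.
by rewrite mul0r.
Qed.

Theorem theorem3p2 (R : realType) (G : topologicalGroupType)
    (hausdorffG : hausdorff_space G) (lcG : locally_compact [set: G])
    (A : cstarAlgType R) (alpha : G -> A -> A)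
    (actG : strongly_continuous_action alpha)
    (B : cstarAlgType R) (hB : is_reduced_crossed_product alpha B) :
  CCFP A B.
Proof.
move: hB => [mu [H [L [pi [iota [tpi [lam [rho]]]]]]]].
move=> [[haar_mu faithful_pi hL htpi hlam] [rep_rho opn range_rho]].
have faithful_rho := opnorm_faithful rep_rho opn.
move=> e n a /gt0_ReE[eE e0].
(* The final estimate is [2 * d], which must be strictly below [e]. *)
pose d := Re e / 4.
have d0 : 0 < d by exact: divr_gt0.
have near1 : \forall t \near (1%g : G), forall i,
  rnorm (alpha (t^-1)%g (a i) - a i) < d.
  apply: filter_forall => i.
  have /rnorm_continuousP/(_ 1%g d d0) := action_inv_continuous actG (a := a i).
  by rewrite invg1 action1.
have [f [cf f1 f_near]] := bump_integral_sqr1 hausdorffG lcG haar_mu near1.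
have [T [ccT TE]] := exists_compression_map hausdorffG haar_mu hL actG
  faithful_pi htpi hlam faithful_rho range_rho cf f1.
(* A positive bound for all the [a i] at once, so that a single [h] serves the whole family. *)
pose M := \sum_i rnorm (a i) + 1.
have le_M i : rnorm (a i) <= M.
  rewrite /M (bigD1 i) //= -addrA lerDl addr_ge0 //.
  by apply: sumr_ge0 => j _; exact: rnorm_ge0.
have M0 : 0 < M.
  by rewrite ltr_wpDl // sumr_ge0 // => i _; exact: rnorm_ge0.
have dM0 : 0 < d / M by exact: divr_gt0.
have dM20 : 0 < (d / M) ^+ 2 by exact: exprn_gt0.
have cfC := CcR_Cc hausdorffG cf.
(* The support of [h] is chosen after [f], as it depends on how fast the translates of [f] vary. The
   inverse appears because [lam s] involves [f (s^-1 * t)]. *)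
have near2 := near_inv1 (integral_translate_near hausdorffG haar_mu cfC dM20).
have [h [ch h0 h1 h_near]] := bump_integral1 hausdorffG lcG haar_mu near2.
have [C [linC CE C1]] := averaging_operator hausdorffG haar_mu hL hlam ch h0 h1.
have [S [ccS SE]] := exists_averaging_map hausdorffG hL actG
  faithful_pi htpi faithful_rho range_rho ch linC CE C1.
exists S, T; split => // i.
rewrite eE rnorm_lt; apply: (@le_lt_trans _ _ (2 * d)); last by rewrite /d; lra.
apply: (factorization_estimate hausdorffG haar_mu hL actG faithful_pi htpi hlam
  d0 cf f1 ch h0 h1 CE (SE (a i)) TE).
- by move=> t /f_near/(_ i)/ltW.
- move=> s x /h_near near_s x1.
  have lam1 : lam 1%g (embed iota f x) = embed iota f x.
    rewrite /embed (lam_iota hlam); last exact: Cc_embed.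
    by congr iota; apply/funext => t; rewrite invg1 mul1g.
  have le_dM : rnorm (lam s (embed iota f x) - embed iota f x) <= d / M.
    rewrite -(ler_pXn2r (n := 2)) ?nnegrE ?rnorm_ge0 ?(ltW dM0) //.
    rewrite -[X in _ - X]lam1; apply: le_trans near_s.
    have := embed_translate_le hausdorffG haar_mu hL hlam cf s 1%g x1.
    by rewrite mulg1.
  apply: (@le_trans _ _ (M * (d / M))); last by rewrite mulrC mulfVK // gt_eqF.
  by apply: ler_pM; rewrite ?rnorm_ge0.
Qed.
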